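(* Let $E$ be a real AM-space and let $A$ be the generator of a positive $C_0$-semigroup $(T(t))_{t\ge 0}$ on $E$. Let $E_{-1}$ be the associated extrapolation space and $A_{-1}$ the extrapolated generator. Let $B\colon E\to E_{-1}$ be a positive (linear) operator, and suppose that there is a $\lambda>\mathrm{s}(A)$ such that $\operatorname{spr}\bigl((\lambda-A_{-1})^{-1}B\bigr)<1$. Then the part of $A_{-1}+B$ in $E$, i.e. the operator in $E$ with domain $\{f\in E:\ (A_{-1}+B)f\in E\}$ acting as $f\mapsto (A_{-1}+B)f$, generates a positive $C_0$-semigroup on $E$.
   Context: An AM-space is a Banach lattice $E$ with $\|\sup\{f,g\}\|=\sup\{\|f\|,\|g\|\}$ for all $f,g\in E_+$, where $E_+$ is the positive cone. A $C_0$-semigroup $(T(t))_{t\ge0}$ on $E$ is positive if $T(t)E_+\subseteq E_+$ for all $t\ge0$. For real spaces, spectral notions refer to complexifications. $\rho(\cdot)$, $\sigma(\cdot)$ denote resolvent set and spectrum, $R(\lambda,A)=(\lambda-A)^{-1}$, $\mathrm{s}(A)=\sup\{\operatorname{Re}\lambda:\lambda\in\sigma(A)\}$ is the spectral bound, and $\operatorname{spr}$ denotes the spectral radius; $\lambda>\mathrm{s}(A)$ means $\lambda$ is real. Extrapolation space: for a fixed $\lambda\in\rho(A)$ (which may be taken real), $E_{-1}$ is the completion of $E$ with respect to the norm $\|f\|_{-1}:=\|R(\lambda,A)f\|$; different choices of $\lambda$ give the same space with equivalent norms. Each $T(t)$ extends uniquely to a bounded operator $T_{-1}(t)$ on $E_{-1}$;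 $(T_{-1}(t))_{t\ge0}$ is a $C_0$-semigroup on $E_{-1}$ whose generator is denoted $A_{-1}$, and $\operatorname{dom}(A_{-1})=E$. Order on $E_{-1}$: $E_{-1,+}$ denotes the closure of $E_+$ in $E_{-1}$, and $f\in E_{-1}$ is called positive if $f\in E_{-1,+}$. A linear operator $B\colon E\to E_{-1}$ is positive if $Bf\in E_{-1,+}$ for all $f\in E_+$. For such $B$ and $\lambda>\mathrm{s}(A)$, the operator $(\lambda-A_{-1})^{-1}B$ is automatically a bounded operator on $E$, and its spectral radius is taken in $\mathcal{L}(E)$, the space of bounded linear operators on $E$. *)

(* Defs.v *)
From HB Require Import structures.
From mathcomp Require Import all_boot all_order all_algebra.
From mathcomp Require Import complex.
From mathcomp Require Import all_classical all_reals all_analysis.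

Set Implicit Arguments.
Unset Strict Implicit.
Unset Printing Implicit Defensive.

Import Order.TTheory GRing.Theory Num.Theory.
Import numFieldNormedType.Exports.

Local Open Scope classical_set_scope.
Local Open Scope ring_scope.

(* The order is a field of the mixin rather than an [Order.Lattice] structure:
   Hierarchy Builder accepts no join of [Order.Lattice] with an additive
   structure declared after [realDomainType]. *)
HB.mixin Record isBanachLattice (R : realType) E
    & CompleteNormedModule R E := {
  vle : E -> E -> Prop ;
  vjoin : E -> E -> E ;
  vmeet : E -> E -> E ;
  vle_refl : forall f, vle f f ;
  vle_anti : forall f g, vle f g -> vle g f -> f = g ;
  vle_trans : forall f g h, vle f g -> vle g h -> vle f h ;
  vle_join : forall f g h, vle (vjoin f g) h <-> vle f h /\ vle g h ;
  vle_meet : forall f g h, vle h (vmeet f g) <-> vle h f /\ vle h g ;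
  vleD2r : forall h f g, vle f g -> vle (f + h) (g + h) ;
  scaler_vge0 : forall (a : R) f, 0 <= a -> vle 0 f -> vle 0 (a *: f) ;
  (* |f| <= |g| implies ||f|| <= ||g||, with |f| = sup {f, -f} the modulus *)
  vle_norm : forall f g, vle (vjoin f (- f)) (vjoin g (- g)) -> `|f| <= `|g| ;
}.

#[short(type="banachLatticeType")]
HB.structure Definition BanachLattice (R : realType) :=
  { E of CompleteNormedModule R E & isBanachLattice R E }.

Definition pos_cone (R : realType) (E : banachLatticeType R) : set E :=
  [set f | vle 0 f].

Definition AM_space (R : realType) (E : banachLatticeType R) : Prop :=
  forall f g : E, pos_cone f -> pos_cone g ->
    `|vjoin f g| = Num.max `|f| `|g|.

(* Values of [app] outside [dom] are irrelevant: operators are compared with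
   [same_operator]. *)
Record operator (V W : Type) := Operator { dom : set V ; app :> V -> W }.

Definition same_operator (V W : Type) (A B : operator V W) : Prop :=
  dom A = dom B /\ forall x, dom A x -> A x = B x.

(* [(l - A)^-1 y], for a scalar [l] such that [l - A] is bijective *)
Definition resolvent (K : pzRingType) (V : lmodType K) (A : operator V V)
    (l : K) (y : V) : V :=
  xget 0 [set x | dom A x /\ l *: x - A x = y].

(* The pair (x, y) stands for x + i y. *)
Definition complexification (E : Type) : Type := (E * E)%type.

Section Complexification.
Variables (R : realType) (E : normedModType R).
Local Notation EC := (complexification E).

(* All the usual norms on the complexification induce the product topology, so
   that continuity of a linear map is its boundedness for any of them. *)
HB.instance Definition _ := Topological.copy EC (E * E)%type.
HB.instance Definition _ := GRing.Zmodule.copy EC (E * E)%type.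

Definition scalec (l : R[i]) (z : EC) : EC :=
  (complex.Re l *: z.1 - complex.Im l *: z.2,
   complex.Re l *: z.2 + complex.Im l *: z.1).

Lemma scalecA (k l : R[i]) (z : EC) : scalec k (scalec l z) = scalec (k * l) z.
Proof.
case: k l z => [a b] [c d] [x y]; rewrite /scalec /=; congr pair.
  rewrite !scalerBr !scalerDr !scalerBl !scalerDl !scalerA !opprD !addrA.
  by rewrite addrAC; congr (_ - _); rewrite addrAC.
rewrite !scalerBr !scalerDr !scalerBl !scalerDl !scalerA !addrA.
by rewrite addrAC; congr (_ + _); rewrite addrAC.
Qed.

Lemma scalec1 : left_id 1 scalec.
Proof. by case=> x y; rewrite /scalec /= !scale1r !scale0r subr0 addr0. Qed.

Lemma scalecDr : right_distributive scalec +%R.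
Proof.
case=> [a b] [x y] [x' y']; rewrite /scalec /=; congr pair => /=.
  by rewrite !scalerDr opprD addrACA.
by rewrite !scalerDr addrACA.
Qed.

Lemma scalecDl z : {morph scalec^~ z : k l / k + l}.
Proof.
case: z => x y [a b] [c d]; rewrite /scalec /=; congr pair => /=.
  by rewrite !scalerDl opprD addrACA.
by rewrite !scalerDl addrACA.
Qed.

HB.instance Definition _ :=
  GRing.Zmodule_isLmodule.Build R[i] EC scalecA scalec1 scalecDr scalecDl.

End Complexification.

Section Spectrum.
Variables (R : realType) (E : normedModType R).
Local Notation EC := (complexification E).

Definition complexify (A : operator E E) : operator EC EC :=
  Operator [set z : EC | dom A z.1 /\ dom A z.2] (fun z => (A z.1, A z.2)).

Definition resolvent_set (A : operator E E) : set R[i] :=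
  [set l | let AC := complexify A in
    exists2 Q : EC -> EC, continuous Q &
      (forall w, dom AC (Q w) /\ l *: Q w - AC (Q w) = w) /\
      (forall z, dom AC z -> Q (l *: z - AC z) = z)].

Definition spectrum (A : operator E E) : set R[i] := ~` resolvent_set A.

(* Both suprema are -oo when the spectrum is empty. *)
Definition spectral_bound (A : operator E E) : \bar R :=
  ereal_sup [set (complex.Re l)%:E | l in spectrum A].

Definition spectral_radius (Q : E -> E) : \bar R :=
  ereal_sup [set (ComplexField.Normc.normc l)%:E
            | l in spectrum (Operator setT Q)].

End Spectrum.

Section Semigroups.
Variables (R : realType) (E : normedModType R).

(* Only the values of [T] at nonnegative times are relevant. *)
Record C0_semigroup (T : R -> {linear E -> E}) : Prop := {
  C0_bounded : forall t, 0 <= t -> continuous (T t) ;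
  C0_id : forall f, T 0 f = f ;
  C0_add : forall s t, 0 <= s -> 0 <= t -> forall f, T (s + t) f = T s (T t f) ;
  C0_strong : forall f, T t f @[t --> 0^'+] --> f ;
}.

Definition generator (T : R -> {linear E -> E}) : operator E E :=
  let quotient f t := t^-1 *: (T t f - f) in
  Operator [set f | cvg (quotient f t @[t --> 0^'+])]
           (fun f => lim (quotient f t @[t --> 0^'+])).

Definition generates (A : operator E E) (T : R -> {linear E -> E}) : Prop :=
  C0_semigroup T /\ same_operator A (generator T).

End Semigroups.

Definition positive_semigroup (R : realType) (E : banachLatticeType R)
    (T : R -> {linear E -> E}) : Prop :=
  forall t, 0 <= t -> forall f, pos_cone f -> pos_cone (T t f).

Section Extrapolation.
Variables (R : realType) (E : banachLatticeType R).
Variables (Em1 : completeNormedModType R) (j : {linear E -> Em1}).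

(* [j] exhibits [Em1] as the completion of [E] for ||R(mu, A) f||, for a real
   mu in the resolvent set of A. *)
Record extrapolation_space (A : operator E E) (mu : R) : Prop := {
  extr_mu : resolvent_set A mu%:C%C ;
  extr_norm : forall f, `|j f| = `|resolvent A mu f| ;
  extr_dense : dense (range j) ;
}.

Definition extrapolated_semigroup (T : R -> {linear E -> E})
    (Tm1 : R -> {linear Em1 -> Em1}) : Prop :=
  forall t, 0 <= t -> continuous (Tm1 t) /\ forall f, Tm1 t (j f) = j (T t f).

Definition extr_cone : set Em1 := closure (j @` @pos_cone R E).

Definition extr_positive (B : E -> Em1) : Prop :=
  forall f, pos_cone f -> extr_cone (B f).

(* The element of E that [j] identifies with [y], if there is one. *)
Definition in_E (y : Em1) : E := xget 0 [set f | j f = y].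

(* (l - A_{-1})^-1 B, as an operator on E *)
Definition resolvent_pert (Am1 : operator Em1 Em1) (B : E -> Em1) (l : R)
    (f : E) : E :=
  in_E (resolvent Am1 l (B f)).

(* The part of A_{-1} + B in E *)
Definition part_pert (Am1 : operator Em1 Em1) (B : E -> Em1) : operator E E :=
  Operator [set f | dom Am1 (j f) /\ range j (Am1 (j f) + B f)]
           (fun f => in_E (Am1 (j f) + B f)).

End Extrapolation.

(* Main.v *)
Require Import Defs.
From HB Require Import structures.
From mathcomp Require Import all_boot all_order all_algebra.
From mathcomp Require Import complex.
From mathcomp Require Import all_classical all_reals all_analysis.
From mathcomp Require Import ring lra.

Set Implicit Arguments.
Unset Strict Implicit.
Unset Printing Implicit Defensive.

Import Order.TTheory GRing.Theory Num.Theory.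
Import numFieldNormedType.Exports.

Local Open Scope classical_set_scope.
Local Open Scope ring_scope.

(** Fix [l] above the spectral bound of [A] with [spr ((l - A_{-1})^-1 B) < 1],
    write [R m] for the resolvent of [A] and [K m] for [(m - A_{-1})^-1 B].
    For [m >= l] the equation [(m - C) f = g] for the part [C] of [A_{-1} + B]
    in [E] is equivalent to [f - K m f = R m g].  The proof solves it, bounds
    the powers of the resolvent so obtained and concludes by the generation
    theorem of Hille and Yosida.

    - Positivity.  Dissipativity of [A] with respect to a weighted supremum of
      [`|(T t f)^-|] makes [R m] positive for large [m]; positivity then
      propagates down the half line [m >= l], which lies in the resolvent set
      ([resolvent_positive]).  Hence [0 <= K m <= K l].  The same propagation,
      for the bounded operator [K l] and the half line [m >= 1], turns the
      hypothesis on the spectral radius into positivity of [P := (1 - K l)^-1]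
      ([positive_neumann]).

    - Solvability.  If [x - s K m x = g] with [0 <= s <= 1], then
      [|x| <= |g| + K l |x|], so that [|x| <= P |g|].  This bound is uniform in
      [s] and [m], and the method of continuity inverts [1 - K m]
      ([neumann_inverse]).

    - The power estimate ([perturbed_power_bound]).  Let [w >= l] be a growth
      bound of [T].  For [f >= 0] put [f_ n := ((m - w) (m - C)^-1)^n f] and
      [G := (m - w) R m]; then [f_ n = G f_ n.-1 + K m f_ n].  With
      [h := sup_(k <= n) f_ k] and [v := K l h] the resolvent identity gives
      [G v + K m h <= v], so [f_ n - v <= G (f_ n.-1 - v)] and, by iteration,
      [f_ n <= G^n f + K l h].  Therefore [h <= P (sup_(k <= n) G^k f)].  In an
      AM-space the norm of this supremum is the largest of the norms
      [`|G^k f|], which are bounded since [w] is a growth bound: the bound on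
      [`|f_ n|] does not depend on [n].

    - The domain of [C] is dense, because [(m - w) R m f] tends to [f] and
      [K m f] to [0] as [m] grows.

    - Generation ([euler_semigroup], [hille_yosida]).  Up to a shift of [C] by
      [w], the powers [(1 - 2^-k C)^-n] with [n] the integer part of [2^k t]
      converge to the semigroup, by an estimate of the effect of halving the
      step.

    The extrapolation space enters only through the isometry [mu - A_{-1}] of
    [E] onto [Em1]: transported along it, [j] is the resolvent of [A] at [mu],
    [A_{-1}] is [A], and [K m] becomes [b + (mu - m) R m b] for a linear
    [b : E -> E] ([extr_isoP], [extr_resolvent]).  Since resolvents are at hand
    from the start, difference quotients along orbits in their range do the work
    of time averages ([generates_dense], [extr_derivative]). *)

(** * Linear identities in modules *)

Section LinearIdentities.
Variables (K : comNzRingType) (V : lmodType K).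

(** Formal linear combinations, with atoms numbered by their place in a list of
    vectors. *)
Inductive lexp :=
  LAtom of nat | LZero | LAdd of lexp & lexp | LOpp of lexp
| LScale of K & lexp.

Fixpoint leval (s : seq V) (e : lexp) : V :=
  match e with
  | LAtom n => s`_n
  | LZero => 0
  | LAdd a b => leval s a + leval s b
  | LOpp a => - leval s a
  | LScale k a => k *: leval s a
  end.

Fixpoint lcoef (n : nat) (e : lexp) : K :=
  match e with
  | LAtom m => if eqn m n then 1 else 0
  | LZero => 0
  | LAdd a b => lcoef n a + lcoef n b
  | LOpp a => - lcoef n a
  | LScale k a => k * lcoef n a
  end.

Fixpoint lagree (n : nat) (e1 e2 : lexp) : Prop :=
  if n is m.+1 then lcoef m e1 = lcoef m e2 /\ lagree m e1 e2 else True.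

Lemma leval_sum s e : leval s e = \sum_(i < size s) lcoef i e *: s`_i.
Proof.
elim: e => /= [m||a -> b ->|a ->|k a ->].
- have [ms|ms] := ltnP m (size s).
    rewrite (bigD1 (Ordinal ms)) //= eqnE eqxx scale1r big1 ?addr0 // => i im.
    case: eqP => [e|_]; last by rewrite scale0r.
    by case/eqP: im; exact: val_inj.
  rewrite nth_default // big1 // => i _; rewrite eqnE; case: eqP => [e|_].
    by move: (ltn_ord i); rewrite -e ltnNge ms.
  by rewrite scale0r.
- by rewrite big1 // => i _; rewrite scale0r.
- by rewrite -big_split /=; apply: eq_bigr => i _; rewrite scalerDl.
- by rewrite -sumrN; apply: eq_bigr => i _; rewrite scaleNr.
- by rewrite scaler_sumr; apply: eq_bigr => i _; rewrite scalerA.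
Qed.

Lemma lagreeP s e1 e2 : lagree (size s) e1 e2 -> leval s e1 = leval s e2.
Proof.
move=> h; rewrite !leval_sum; apply: eq_bigr => i _; congr (_ *: _).
have := ltn_ord i; move: (nat_of_ord i) => k.
elim: (size s) h => // n ih /= [h /ih{}ih].
by rewrite ltnS leq_eqVlt => /orP[/eqP ->|].
Qed.

End LinearIdentities.

(* Atoms are compared up to unification: the same vector may occur with
   different, convertible structure instances. *)
Ltac lfind a s :=
  match s with
  | ?b :: _ => let _ := match goal with _ => unify a b end in constr:(0%N)
  | _ :: ?t => let n := lfind a t in constr:(S n)
  end.

Ltac latoms t s :=
  match t with
  | (?a + ?b)%R => let s := latoms a s in latoms b s
  | (- ?a)%R => latoms a s
  | (_ *: ?a)%R => latoms a s
  | 0%R => s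
  (* the first branch fails, and the second is taken, if [a] is a new atom *)
  | ?a => match s with
          | _ => let n := lfind a s in s
          | _ => constr:(a :: s)
          end
  end.

Ltac lreify K t s :=
  match t with
  | (?a + ?b)%R => let a := lreify K a s in let b := lreify K b s in
                   constr:(@LAdd K a b)
  | (- ?a)%R => let a := lreify K a s in constr:(@LOpp K a)
  | (?k *: ?a)%R => let a := lreify K a s in constr:(@LScale K k a)
  | 0%R => constr:(@LZero K)
  | ?a => let n := lfind a s in constr:(@LAtom K n)
  end.

(** Comparing the coefficients of each atom leaves only equalities in [K], for
    [ring] or [field]. *)
Ltac lmod_coefs K V :=
  lazymatch goal with
  | |- @eq ?T ?x ?y =>
    let s := latoms x (@nil T) in let s := latoms y s in
    let a := lreify K x s in let b := lreify K y s in
    refine (@lagreeP K V s a b _); cbn [lagree lcoef size eqn];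
    repeat (apply: conj)
  end.

Ltac lmod K V := lmod_coefs K V; (exact I || ring).


(** * Banach lattices *)

Local Notation "f <=v g" := (vle f g) (at level 70).

Arguments vle_trans {R s f g h}.
Arguments vle_anti {R s f g}.
Arguments vleD2r {R s} h {f g}.
Arguments vle_norm {R s f g}.

Section BanachLatticeTheory.
Variables (R : realType) (E : banachLatticeType R).
Implicit Types (f g h x y : E) (a c : R).

Lemma vleD f g f' g' : f <=v g -> f' <=v g' -> f + f' <=v g + g'.
Proof.
move=> h h'; apply: (vle_trans (g := g + f')); first exact: vleD2r.
by rewrite ![g + _]addrC; exact: vleD2r.
Qed.

Lemma vsubr_ge0 f g : 0 <=v g - f <-> f <=v g.
Proof.
split=> h; first by have := vleD2r f h; rewrite add0r subrK.
by have := vleD2r (- f) h; rewrite subrr.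
Qed.

Lemma vaddr_ge0 f g : 0 <=v f -> 0 <=v g -> 0 <=v f + g.
Proof. by move=> hf hg; have := vleD hf hg; rewrite addr0. Qed.

Lemma vleN f g : f <=v g -> - g <=v - f.
Proof. by move/vsubr_ge0 => h; apply/vsubr_ge0; rewrite opprK addrC. Qed.

Lemma vle_oppr_le0 f : 0 <=v f -> - f <=v 0.
Proof. by move/vleN; rewrite oppr0. Qed.

Lemma vleZ a f g : 0 <= a -> f <=v g -> a *: f <=v a *: g.
Proof.
move=> a0 /vsubr_ge0 h; apply/vsubr_ge0; rewrite -scalerBr.
exact: scaler_vge0.
Qed.

Lemma vle_joinl f g : f <=v vjoin f g.
Proof. by have [] := (vle_join f g (vjoin f g)).1 (vle_refl _). Qed.

Lemma vle_joinr f g : g <=v vjoin f g.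
Proof. by have [] := (vle_join f g (vjoin f g)).1 (vle_refl _). Qed.

Definition vabs f : E := vjoin f (- f).

Lemma vle_abs f : f <=v vabs f. Proof. exact: vle_joinl. Qed.

Lemma vleN_abs f : - f <=v vabs f. Proof. exact: vle_joinr. Qed.

Lemma vabs_le f h : f <=v h -> - f <=v h -> vabs f <=v h.
Proof. by move=> h1 h2; apply/vle_join. Qed.

Lemma vabs_ge0 f : 0 <=v vabs f.
Proof.
have h := vleD (vle_abs f) (vleN_abs f); rewrite subrr in h.
have -> : vabs f = 2^-1 *: (vabs f + vabs f) by lmod_coefs R E => //; field.
by apply: scaler_vge0 => //; rewrite invr_ge0.
Qed.

Lemma vabs_pos f : 0 <=v f -> vabs f = f.
Proof.
move=> f0; apply: vle_anti (vle_abs f); apply: vabs_le; first exact: vle_refl.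
exact: vle_trans (vle_oppr_le0 f0) f0.
Qed.

Lemma vnorm_abs_le f g : vabs f <=v vabs g -> `|f| <= `|g|.
Proof. exact: vle_norm. Qed.

Lemma vnorm_abs f : `|vabs f| = `|f|.
Proof.
have e : vabs (vabs f) = vabs f by apply/vabs_pos/vabs_ge0.
by apply/eqP; rewrite eq_le !vnorm_abs_le ?e //; exact: vle_refl.
Qed.

Lemma vnorm_le f g : vabs f <=v g -> `|f| <= `|g|.
Proof.
move=> h; apply: vnorm_abs_le; rewrite (@vabs_pos g) //.
exact: vle_trans (vabs_ge0 f) h.
Qed.

Lemma vnorm_le_pos f g : 0 <=v f -> f <=v g -> `|f| <= `|g|.
Proof. by move=> f0 fg; apply: vnorm_le; rewrite vabs_pos. Qed.

Definition vneg f : E := vjoin (- f) 0.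

Lemma vneg_ge0 f : 0 <=v vneg f. Proof. exact: vle_joinr. Qed.

Lemma vleN_neg f : - f <=v vneg f. Proof. exact: vle_joinl. Qed.

Lemma vneg_le f h : 0 <=v h -> - f <=v h -> vneg f <=v h.
Proof. by move=> h1 h2; apply/vle_join. Qed.

Lemma vneg_le_abs f : vneg f <=v vabs f.
Proof. by apply: vneg_le; [exact: vabs_ge0 | exact: vleN_abs]. Qed.

Lemma vneg_pos f : 0 <=v f -> vneg f = 0.
Proof.
move=> f0; apply: vle_anti (vneg_ge0 f); apply: vneg_le (vle_refl _) _.
exact: vle_oppr_le0.
Qed.

Lemma vneg_eq0 f : vneg f = 0 -> 0 <=v f.
Proof.
by move=> h; have := vleN (vleN_neg f); rewrite h oppr0 opprK.
Qed.

Lemma vnegD f g : vneg (f + g) <=v vneg f + vneg g.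
Proof.
apply: vneg_le; first by apply: vaddr_ge0; exact: vneg_ge0.
by rewrite opprD; apply: vleD; exact: vleN_neg.
Qed.

Lemma vnegZ a f : 0 < a -> vneg (a *: f) = a *: vneg f.
Proof.
move=> a0; have le b g : 0 < b -> vneg (b *: g) <=v b *: vneg g.
  move=> b0; apply: vneg_le.
    by apply: scaler_vge0 (vneg_ge0 _); exact: ltW.
  by rewrite -scalerN; apply: vleZ (vleN_neg _); exact: ltW.
apply: vle_anti; first exact: le.
have := le a^-1 (a *: f); rewrite invr_gt0 => /(_ a0).
rewrite scalerA mulVf ?gt_eqF // scale1r => /(vleZ (ltW a0)).
by rewrite scalerA mulfV ?gt_eqF // scale1r.
Qed.

Lemma vneg_norm f : `|vneg f| <= `|f|.
Proof.
rewrite -[X in _ <= X]vnorm_abs; apply: vnorm_le_pos (vneg_le_abs f).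
exact: vneg_ge0.
Qed.

Lemma vneg_dist f g : 0 <=v g -> `|vneg f| <= `|f - g|.
Proof.
move=> g0; rewrite -[X in _ <= X]vnorm_abs; apply: vnorm_le_pos.
  exact: vneg_ge0.
apply: vneg_le; first exact: vabs_ge0.
apply: vle_trans (vleN_abs _); rewrite opprB; apply/vsubr_ge0.
by rewrite opprK subrK.
Qed.

(** The cone is closed, since by [vneg_dist] the distance of [f] to it bounds
    the norm of the negative part. *)
Lemma vge0_approx f :
  (forall e, 0 < e -> exists2 g, 0 <=v g & `|f - g| <= e) -> 0 <=v f.
Proof.
move=> h; apply: vneg_eq0; apply/eqP; rewrite -normr_le0.
apply/ler_addgt0Pr => e e0; rewrite add0r.
have [g g0 fg] := h _ e0.
exact: le_trans (vneg_dist f g0) fg.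
Qed.

Fixpoint vsup (u : nat -> E) (n : nat) : E :=
  if n is m.+1 then vjoin (vsup u m) (u n) else u 0%N.

Lemma vle_sup u n k : (k <= n)%N -> u k <=v vsup u n.
Proof.
elim: n => [|n ih] /=; first by rewrite leqn0 => /eqP ->; exact: vle_refl.
rewrite leq_eqVlt => /orP[/eqP ->|kn]; first exact: vle_joinr.
by apply: vle_trans (ih kn) _; exact: vle_joinl.
Qed.

Lemma vsup_le u n h : (forall k, (k <= n)%N -> u k <=v h) -> vsup u n <=v h.
Proof.
elim: n => [|n ih] hu /=; first exact: hu.
apply/vle_join; split; last exact: hu.
by apply: ih => k kn; apply: hu; exact: leqW.
Qed.

(** On a general Banach lattice a bound would have to grow with [n]; that it
    does not is all that the AM-property is used for. *)
Lemma AM_vsup_norm u n c : AM_space E -> (forall k, 0 <=v u k) ->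
  (forall k, `|u k| <= c) -> `|vsup u n| <= c.
Proof.
move=> hE u0 uc; elim: n => [|n ih] /=; first exact: uc.
rewrite hE /pos_cone /=; first by rewrite ge_max ih uc.
  by apply: vle_trans (u0 0%N) _; exact: vle_sup.
exact: u0.
Qed.

End BanachLatticeTheory.

(** * Operators and their real resolvents *)

Section Operators.
Variables (R : realType).
Implicit Types (E F : normedModType R).

Lemma linear_bundle E F (P : E -> F) : linear P ->
  exists P' : {linear E -> F}, P' =1 P.
Proof.
move=> lP.
by exists (HB.pack_for {linear E -> F} P (GRing.isLinear.Build R E F *:%R P lP)).
Qed.

Definition norm_bound E F (c : R) (P : E -> F) : Prop :=
  forall f, `|P f| <= c * `|f|.

Lemma continuous_norm_bound E F (P : {linear E -> F}) :
  continuous P -> exists2 c, 0 < c & norm_bound c P.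
Proof.
move=> cP; have /linear_boundedP h := continuous_linear_bounded 0 (cP 0).
near (pinfty_nbhs R) => c; exists c; first by near: c; exact: nbhs_pinfty_gt.
by near: c; exact: h.
Unshelve. all: by end_near. Qed.

Lemma norm_bound_continuous E F (P : {linear E -> F}) c :
  norm_bound c P -> continuous P.
Proof.
move=> h; apply/linear_bounded_continuous/linear_boundedP.
exists c; split=> [|r cr x]; first exact: num_real.
by apply: le_trans (h x) _; apply: ler_wpM2r => //; exact: ltW.
Qed.

(** In a complete space it suffices to find, for each [e], one point that the
    values of [g] eventually approach within [e]. *)
Lemma cvg_of_approximants (V : completeNormedModType R) (T : Type) (F : set_system T)
    (g : T -> V) : ProperFilter F ->
  (forall e, 0 < e -> exists y, \forall t \near F, `|y - g t| < e) ->
  cvg (g t @[t --> F]).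
Proof.
move=> FF h; apply/cauchy_cvgP/cauchy_exP => e /h[y hy].
exists y; near=> t; rewrite -ball_normE /=.
by near: t.
Unshelve. all: by end_near. Qed.

Definition linear_operator E (A : operator E E) : Prop :=
  forall a f g, dom A f -> dom A g ->
    dom A (a *: f + g) /\ A (a *: f + g) = a *: A f + A g.

(** Existence and uniqueness of the solution of [l f - A f = g], packed into one
    equivalence so that it can be used in both directions. *)
Definition resolvent_of E (A : operator E E) (l : R) (P : E -> E) : Prop :=
  forall f g, (dom A f /\ l *: f - A f = g) <-> f = P g.

Section ResolventOf.
Variables (E : normedModType R) (A : operator E E).

Lemma resolvent_dom l P g : resolvent_of A l P -> dom A (P g).
Proof. by move=> h; have [] := (h (P g) g).2 erefl. Qed.

Lemma resolvent_eq l P g : resolvent_of A l P -> l *: P g - A (P g) = g.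
Proof. by move=> h; have [] := (h (P g) g).2 erefl. Qed.

Lemma resolvent_app l P g : resolvent_of A l P -> A (P g) = l *: P g - g.
Proof. by move=> h; rewrite -[X in _ = _ - X](resolvent_eq g h); lmod R E. Qed.

Lemma resolventK l P f : resolvent_of A l P -> dom A f ->
  P (l *: f - A f) = f.
Proof. by move=> h df; apply/esym/h. Qed.

Lemma resolvent_inj l P f g : resolvent_of A l P -> P f = P g -> f = g.
Proof. by move=> h e; rewrite -(resolvent_eq f h) e (resolvent_eq g h). Qed.

Lemma resolvent_ofE l P : resolvent_of A l P -> resolvent A l =1 P.
Proof.
move=> h g; rewrite /resolvent; case: xgetP => [_ -> /(h _ _)//|].
by move=> /(_ (P g)) []; exact: (h _ _).2.
Qed.

(** Both sides solve [l x - A x = g + (l - m) Q g]. *)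
Lemma resolvent_identity l m P Q g : resolvent_of A l P -> resolvent_of A m Q ->
  P (g + (l - m) *: Q g) = Q g.
Proof.
move=> hP hQ; apply/esym/hP; split; first exact: resolvent_dom hQ.
by rewrite (resolvent_app g hQ); lmod R E.
Qed.

Lemma complexify_real l (z : complexification E) :
  l%:C%C *: z - complexify A z = (l *: z.1 - A z.1, l *: z.2 - A z.2).
Proof. by congr pair => /=; rewrite !scale0r ?subr0 ?addr0. Qed.

Lemma real_resolvent l : linear_operator A -> resolvent_set A l%:C%C ->
  exists P : {linear E -> E}, continuous P /\ resolvent_of A l P.
Proof.
(* A solution [f] of the real equation gives the solution [(f, f)] of the complex
   one; the right-hand side [(g, 0)] would instead require [dom A 0]. *)
move=> lA [Q cQ [Qr Ql]]; pose P g := (Q (g, g)).1.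
have hP : resolvent_of A l P.
  move=> f g; split=> [[df efg]|->].
    have /(_ (conj df df)) := Ql (f, f); rewrite /P.
    by rewrite complexify_real /= efg => ->.
  have [[d1 _] e] := Qr (g, g); split; first exact: d1.
  by move: e; rewrite complexify_real => /(congr1 fst).
have linP : linear P.
  move=> a g h; apply/esym/hP.
  have [d e] := lA a _ _ (resolvent_dom g hP) (resolvent_dom h hP).
  by split=> //; rewrite e !(resolvent_app _ hP); lmod R E.
have [P' eP] := linear_bundle linP; exists P'; split.
  have -> : (P' : E -> E) = P by apply/funext => ?; exact: eP.
  move=> g; rewrite /P.
  apply: (@cvg_comp _ _ _ (fun g => Q (g, g)) fst _ (nbhs (Q (g, g)))).
    apply: (@cvg_comp _ _ _ (fun g => (g, g)) Q _ (nbhs ((g, g) : E * E))).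
      by apply: cvg_pair; exact: cvg_id.
    exact: cQ.
  exact: (@cvg_fst _ _ (nbhs (Q (g, g)).1) (nbhs (Q (g, g)).2)).
by move=> f g; rewrite eP; exact: hP.
Qed.

End ResolventOf.

End Operators.

(** * Positive operators *)

Section PositiveOperators.
Variables (R : realType) (E : banachLatticeType R).
Implicit Types (f g x : E) (P K : {linear E -> E}).

Definition positive_op (F : banachLatticeType R) (P : E -> F) : Prop :=
  forall f, 0 <=v f -> 0 <=v P f.

Lemma positive_le P f g : positive_op P -> f <=v g -> P f <=v P g.
Proof. by move=> hP /vsubr_ge0/hP h; apply/vsubr_ge0; rewrite -linearB. Qed.

Lemma positive_abs P f : positive_op P -> vabs (P f) <=v P (vabs f).
Proof.
move=> hP; apply: vabs_le; first exact/positive_le/vle_abs.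
by rewrite -linearN; exact/positive_le/vleN_abs.
Qed.

Lemma positive_iter P n f : positive_op P -> 0 <=v f -> 0 <=v iter n P f.
Proof. by move=> hP f0; elim: n => //= n; exact: hP. Qed.

Lemma positive_iter_abs P n f : positive_op P ->
  vabs (iter n P f) <=v iter n P (vabs f).
Proof.
move=> hP; elim: n => [|n ih] /=; first exact: vle_refl.
by apply: vle_trans (positive_abs _ hP) _; exact: positive_le.
Qed.

(** If [P] were unbounded there would be [x_ n >= 0] of norm [2 ^- n] with
    [`|P (x_ n)| > 2 ^ n], and [P] would take no value at [\sum_n x_ n]. *)
Lemma positive_bounded P : positive_op P -> exists2 c, 0 < c & norm_bound c P.
Proof.
move=> hP; apply: contrapT => nb.
have /choice[u hu] : forall n : nat, exists f, 4 ^+ n * `|f| < `|P f|.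
  move=> n; apply: contrapT => h; apply: nb; exists (4 ^+ n).
    exact: exprn_gt0.
  by move=> f; rewrite leNgt; apply/negP => hf; apply: h; exists f.
have u0 n : 0 < `|u n|.
  rewrite normr_gt0; apply/eqP => e; have := hu n.
  by rewrite e linear0 !normr0 mulr0 ltxx.
pose x n : E := (2^-1 ^+ n / `|u n|) *: vabs (u n).
have c0 n : 0 < 2^-1 ^+ n / `|u n|.
  by rewrite divr_gt0 // exprn_gt0.
have x0 n : 0 <=v x n.
  by apply: scaler_vge0; [exact/ltW/c0 | exact: vabs_ge0].
have nx n : `|x n| = 1 * 2^-1 ^+ n.
  by rewrite normrZ (gtr0_norm (c0 n)) vnorm_abs divfK ?mul1r // gt_eqF.
have Px n : 2 ^+ n <= `|P (x n)|.
  rewrite linearZ normrZ (gtr0_norm (c0 n)).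
  apply: (@le_trans _ _ (2^-1 ^+ n / `|u n| * (4 ^+ n * `|u n|))).
    rewrite mulrCA -mulrA mulVf ?gt_eqF // mulr1 -exprMn.
    by rewrite (_ : 4 * 2^-1 = 2) //; field.
  rewrite ler_wpM2l ?(ltW (c0 n)) //; apply: le_trans (ltW (hu n)) _.
  exact/vnorm_le/positive_abs.
have cx : cvgn (series x).
  apply: normed_cvg; rewrite (_ : [normed series x] = series (geometric 1 2^-1)).
    by apply: is_cvg_geometric_series; rewrite ger0_norm // invf_lt1 // ltr1n.
  apply/funext => n /=; rewrite /series /=; apply: eq_bigr => i _; exact: nx.
have xs n : x n <=v limn (series x).
  apply/vsubr_ge0/vge0_approx => e e0.
  have /cvgrPdist_le/(_ e e0)[N _ hN] := cx.
  exists (series x (maxn N n.+1) - x n).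
    apply/vsubr_ge0; elim: (maxn N n.+1) (leq_maxr N n.+1) => // m ih.
    have s0 k : 0 <=v series x k.
      elim: k => [|k ihk]; first by rewrite /series /= big_geq //; exact: vle_refl.
      by rewrite seriesSr; exact: vaddr_ge0.
    rewrite ltnS leq_eqVlt seriesSr => /orP[/eqP -> |/ih h].
      by rewrite -[X in X <=v _]add0r; exact: vleD2r.
    by rewrite -[X in X <=v _]addr0; exact: vleD.
  have := hN (maxn N n.+1) (leq_maxl _ _).
  by congr (_ <= _); congr `|_|; lmod R E.
have PL n : 2 ^+ n <= `|P (limn (series x))|.
  apply: le_trans (Px n) _; apply: vnorm_le_pos; first exact: hP.
  exact: positive_le.
have := truncnS_gt `|P (limn (series x))|; rewrite ltNge => /negP; apply.
apply: le_trans (PL (Num.truncn `|P (limn (series x))|).+1).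
by rewrite -natrX ler_nat; exact/ltnW/ltn_expl.
Qed.

(** A negative part that is dominated by a strict contraction of itself
    vanishes. *)
Lemma positive_contraction P c d x : positive_op P -> norm_bound c P ->
  0 <= d -> d * c < 1 -> d *: P x <=v x -> 0 <=v x.
Proof.
move=> hP bP d0 dc h; apply: vneg_eq0; apply/eqP; rewrite -normr_le0.
have h1 : vneg x <=v d *: P (vneg x).
  apply: vneg_le; first exact/scaler_vge0/hP/vneg_ge0.
  apply: vle_trans (vleN h) _; rewrite -scalerN -linearN; apply: vleZ => //.
  exact/positive_le/vleN_neg.
have := vnorm_le_pos (vneg_ge0 x) h1; rewrite normrZ (ger0_norm d0) => h2.
have h3 : `|vneg x| <= d * c * `|vneg x|.
  by apply: le_trans h2 _; rewrite -mulrA; exact: ler_wpM2l.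
rewrite -(pmulr_rle0 _ (_ : 0 < 1 - d * c)) ?subr_gt0 //.
by rewrite mulrBl mul1r subr_le0.
Qed.

(** Positivity of the resolvent propagates down a half line of the resolvent
    set: from [m] to nearby [n < m], because [x = (n - A)^-1 g] satisfies
    [x >= (m - n) (m - A)^-1 x], and resolvents are locally bounded. *)
Lemma resolvent_positive (A : operator E E) (P : R -> {linear E -> E}) (l L : R) :
  (forall n, l <= n -> continuous (P n) /\ resolvent_of A n (P n)) ->
  (forall n, L <= n -> positive_op (P n)) ->
  forall n, l <= n -> positive_op (P n).
Proof.
move=> hP hL.
pose S : set R := [set m | l <= m /\ forall n, m <= n -> positive_op (P n)].
suff : S l by case.
have Sn : S !=set0.
  exists (Num.max l L); split; first by rewrite le_max lexx.
  by move=> n; rewrite ge_max => /andP[_ /hL].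
have Sl : lbound S l by move=> m [].
have hl : has_lbound S by exists l.
set i := inf S; have li : l <= i by exact: lb_le_inf.
have [ci ri] := hP _ li; have [c c0 bc] := continuous_norm_bound ci.
pose e := (8 * c)^-1; have e0 : 0 < e by rewrite invr_gt0 mulr_gt0.
have [m [lm Sm] mi] := inf_adherent e0 (conj Sn hl); rewrite -/i in mi.
have im : i <= m by exact: (ge_inf hl).
have ce : c * e = 8^-1 by rewrite /e; field; rewrite gt_eqF.
have bm : norm_bound (2 * c) (P m).
  move=> f; have /(congr1 Num.norm) := resolvent_identity f ri (hP _ lm).2.
  have := bc (f + (i - m) *: P m f) => /[swap] ->.
  have h1 : `|f + (i - m) *: P m f| <= `|f| + e * `|P m f|.
    apply: le_trans (ler_normD _ _) _; rewrite lerD2l normrZ.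
    by apply: ler_wpM2r => //; rewrite ler_norml; apply/andP; split; lra.
  move=> h2; have := le_trans h2 (ler_wpM2l (ltW c0) h1).
  rewrite mulrDr mulrA ce -mulrA.
  have : 0 <= `|P m f| by [].
  have : 0 <= c * `|f| by rewrite mulr_ge0 // ltW.
  lra.
have Si : S (Num.max l (i - e)).
  split; first by rewrite le_max lexx.
  move=> n; rewrite ge_max => /andP[ln ien]; have [mn|nm] := leP m n.
    exact: Sm.
  move=> g g0; apply: (@positive_contraction (P m) (2 * c) (m - n)) => //.
  - exact: Sm.
  - by rewrite subr_ge0 ltW.
  - apply: (@le_lt_trans _ _ (2 * e * (2 * c))).
      by apply: ler_wpM2r; [rewrite mulr_ge0 // ltW | lra].
    by rewrite (_ : 2 * e * (2 * c) = 4 * (c * e)) ?ce; lra.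
  - rewrite -{2}(resolvent_identity g (hP _ lm).2 (hP _ ln).2) linearD linearZ.
    by apply/vsubr_ge0; rewrite addrK; exact: Sm.
have il : i <= l by have := ge_inf hl Si; rewrite -/i le_max => /orP[//|]; lra.
have [_ h] := Si; split=> // n ln; apply: h; rewrite ge_max ln /=.
lra.
Qed.

End PositiveOperators.

(** * Semigroups and their generators *)

Lemma expR_le_linear (R : realType) (w e : R) : 0 <= w -> 0 < e ->
  exists2 d, 0 < d &
    forall t, 0 < t < d -> expR (w * t) <= 1 + w * t * (1 + e).
Proof.
move=> w0 e0; have w1 : 0 < w + 1 by rewrite ltr_wpDl.
have e1 : 0 < 1 + e by rewrite addr_gt0.
exists (e / ((1 + e) * (w + 1))); first by rewrite divr_gt0 // mulr_gt0.
move=> t /andP[t0]; rewrite ltr_pdivlMr ?mulr_gt0 // => te.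
set x := w * t; have x0 : 0 <= x by rewrite mulr_ge0 // ltW.
have hx : x * (1 + e) <= e.
  have -> : x * (1 + e) = t * ((1 + e) * (w + 1)) - t * (1 + e) by rewrite /x; ring.
  by rewrite lerBlDr; apply: le_trans (ltW te) _; rewrite lerDl mulr_ge0 // ltW.
have h2 : expR x * (1 - x) <= 1.
  rewrite -[X in _ <= X](expR0 R) -[in X in _ <= X](subrr x) expRD.
  by rewrite ler_wpM2l ?expR_ge0 // expR_ge1Dx.
have h3 : 0 < 1 - x.
  rewrite subr_gt0 ltNge; apply/negP => h.
  have : 1 * (1 + e) <= e by apply: le_trans hx; rewrite ler_wpM2r // ltW.
  by lra.
have h4 : expR x <= 1 + e.
  rewrite -(ler_pM2r h3); apply: le_trans h2 _.
  rewrite (_ : (1 + e) * (1 - x) = 1 + (e - x * (1 + e))); last by ring.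
  by rewrite lerDl subr_ge0.
have : x * expR x <= x * (1 + e) by rewrite ler_wpM2l.
lra.
Qed.

Section SemigroupTheory.
Variables (R : realType) (E : completeNormedModType R).
Implicit Types (f g u v : E) (T : R -> {linear E -> E}) (t s e d : R).

Lemma near_right0 (Q : R -> Prop) :
  (\forall t \near 0^'+, Q t) <-> exists2 d, 0 < d & forall t, 0 < t < d -> Q t.
Proof.
split=> [|[d d0 h]].
  rewrite near_withinE => /nbhs_ballP[d /= d0 h]; exists d => // t /andP[t0 td].
  by apply: h => //; rewrite /ball /= sub0r normrN gtr0_norm.
rewrite near_withinE; apply/nbhs_ballP; exists d => //= t.
rewrite /ball /= sub0r normrN => h1 t0; apply: h; rewrite t0 /=.
by move: h1; rewrite gtr0_norm.
Qed.

Definition right_derivative T f v : Prop :=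
  t^-1 *: (T t f - f) @[t --> 0^'+] --> v.

Lemma right_derivativeP T f v : right_derivative T f v <->
  forall e, 0 < e -> exists2 d, 0 < d &
    forall t, 0 < t < d -> `|v - t^-1 *: (T t f - f)| <= e.
Proof.
split=> [/cvgrPdist_le h e /h/near_right0 //|h].
by apply/cvgrPdist_le => e /h/near_right0.
Qed.

Lemma generatorP T f v : right_derivative T f v <->
  dom (generator T) f /\ generator T f = v.
Proof.
split=> [h|[h <-]]; last exact: h.
by split; [apply/cvg_ex; exists v | exact: cvg_lim].
Qed.

Lemma right_derivative_linear T a f g u v :
  right_derivative T f u -> right_derivative T g v ->
  right_derivative T (a *: f + g) (a *: u + v).
Proof.
move=> hf hg; rewrite /right_derivative.
have -> : (fun t => t^-1 *: (T t (a *: f + g) - (a *: f + g))) =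
    (fun t => a *: (t^-1 *: (T t f - f)) + t^-1 *: (T t g - g)).
  by apply/funext => t; rewrite linearP; lmod R E.
by apply: cvgD => //; apply: cvgZr.
Qed.

Section Generates.
Variables (A : operator E E) (T : R -> {linear E -> E}).
Hypothesis hA : generates A T.

Lemma generatesP f v : right_derivative T f v <-> dom A f /\ A f = v.
Proof.
have [_ [eD eA]] := hA; split=> [/generatorP[]|[df <-]].
  by rewrite -eD => df <-; split=> //; exact: eA.
by apply/generatorP; rewrite -eD -eA.
Qed.

Lemma generates_linear : linear_operator A.
Proof.
move=> a f g df dg; apply/generatesP.
by apply: right_derivative_linear; apply/generatesP.
Qed.

Lemma generates_commutes t f : 0 <= t -> dom A f ->
  dom A (T t f) /\ A (T t f) = T t (A f).
Proof.
move=> t0 df; apply/generatesP.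
have hf : right_derivative T f (A f) by apply/generatesP.
have [cT _ aT _] := hA.1.
have [c c0 hc] := continuous_norm_bound (cT t t0).
apply/right_derivativeP => e e0.
have ec : 0 < e / c by rewrite divr_gt0.
have /right_derivativeP/(_ _ ec)[d d0 h] := hf; exists d => // s sd.
have s0 : 0 <= s by case/andP: sd => /ltW.
rewrite -aT // [s + t]addrC aT // -linearB -linearZ -linearB.
by apply: le_trans (hc _) _; rewrite mulrC -ler_pdivlMr //; exact: h.
Qed.

Lemma resolvent_commutes l P t g : resolvent_of A l P -> 0 <= t ->
  P (T t g) = T t (P g).
Proof.
move=> hP t0; apply/esym/hP.
have [d e] := generates_commutes t0 (resolvent_dom g hP); split=> //.
by rewrite e (resolvent_app g hP) linearB linearZZ; lmod R E.
Qed.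

(** The difference quotients of [P f] at [0] lie in the domain, as [P] commutes
    with the semigroup, and tend to [A (P f) = l *: P f - f]. *)
Lemma generates_dense l (P : {linear E -> E}) f e : resolvent_of A l P ->
  0 < e -> exists2 g, dom A g & `|f - g| <= e.
Proof.
move=> hP e0.
have /right_derivativeP/(_ e e0)[d d0 h] : right_derivative T (P f) (A (P f)).
  by apply/generatesP; split=> //; exact: resolvent_dom hP.
have t0 : 0 < d / 2 by rewrite divr_gt0.
have /h : 0 < d / 2 < d by rewrite t0 ltr_pdivrMr // ltr_pMr // ltr1n.
rewrite -(resolvent_commutes _ hP (ltW t0)) -linearB -linearZ.
rewrite (resolvent_app _ hP) => h1.
exists (P (l *: f - (d / 2)^-1 *: (T (d / 2) f - f))).
  exact: resolvent_dom hP.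
by rewrite linearB linearZZ -normrN; congr (_ <= _): h1; congr `|_|; lmod R E.
Qed.

End Generates.

(** By the uniform boundedness principle [T] is bounded near [0]; the rest is
    the semigroup law. *)
Lemma growth_bound T w0 : C0_semigroup T -> exists M w,
  [/\ 1 <= M, 0 <= w, w0 <= w &
      forall t, 0 <= t -> norm_bound (M * expR (w * t)) (T t)].
Proof.
move=> [cT idT aT sT].
have [d d0 [M M1 hM]] : exists2 d, 0 < d & exists2 M, 1 <= M &
    forall t, 0 <= t <= d -> norm_bound M (T t).
  apply: contrapT => nb.
  have /choice[p hp] : forall n : nat, exists p : R * E,
      0 <= p.1 <= n.+1%:R^-1 /\ n.+1%:R * `|p.2| < `|T p.1 p.2|.
    move=> n; apply: contrapT => h; apply: nb; exists (n.+1%:R^-1).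
      by rewrite invr_gt0.
    exists n.+1%:R; first by rewrite ler1n.
    move=> t tn f; rewrite leNgt; apply/negP => hf; apply: h.
    by exists (t, f).
  have ub : uniform_bounded [set (T (p n).1 : E -> E) | n in setT].
    apply: Banach_Steinhauss.
    - move=> _ [n _ <-]; split; last exact: linearP.
      have [/andP[p0 _] _] := hp n.
      have [c c0 hc] := continuous_norm_bound (cT _ p0).
      move=> r; exists (c * r) => x xr; apply: le_trans (hc x) _.
      by rewrite ler_wpM2l // ltW.
    - move=> f; have /cvgrPdist_le/(_ 1 ltr01)/near_right0[d d0 hd] := sT f.
      have dN : exists N : nat, (N.+1%:R : R)^-1 < d.
        exists (Num.truncn d^-1); rewrite -[X in _ < X]invrK ltf_pV2 ?posrE ?invr_gt0 //.
        exact: truncnS_gt.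
      have [N hN] := dN.
      exists (`|f| + 1 + \sum_(k < N) `|T (p k).1 f|) => _ [n _ <-].
      have S0 m : 0 <= \sum_(k < m) `|T (p k).1 f| by apply: sumr_ge0.
      have [nN|Nn] := ltnP n N.
        rewrite (bigD1 (Ordinal nN)) //= addrCA lerDl addr_ge0 ?addr_ge0 //.
        exact: sumr_ge0.
      rewrite -[X in X <= _]addr0; apply: lerD => //.
      have [/andP[p0 pn] _] := hp n.
      move: p0; rewrite le_eqVlt => /orP[/eqP <-|p0].
        by rewrite idT lerDl.
      have /hd h : 0 < (p n).1 < d.
        rewrite p0 (le_lt_trans pn) // (le_lt_trans _ hN) //.
        by rewrite lef_pV2 ?posrE // ler_nat.
      have -> : T (p n).1 f = f - (f - T (p n).1 f) by lmod R E.
      by apply: le_trans (ler_normB _ _) _; rewrite lerD2l.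
  have [M hM] := ub 1; pose n := Num.truncn M.
  have [_ hn] := hp n; set x := (p n).2 in hn.
  have x0 : 0 < `|x|.
    rewrite normr_gt0; apply/eqP => e.
    by move: hn; rewrite e linear0 !normr0 mulr0 ltxx.
  have := hM (T (p n).1) (ex_intro2 _ _ n I erefl) (`|x|^-1 *: x).
  rewrite normrZ normfV normr_id mulVf ?gt_eqF // => /(_ (lexx _)).
  rewrite linearZZ normrZ normfV normr_id mulrC ler_pdivrMr // => h.
  have := lt_le_trans hn h; rewrite ltr_pM2r // => h1.
  by have := lt_trans h1 (truncnS_gt M); rewrite ltxx.
have M0 : 0 < M by exact: lt_le_trans M1.
pose w := Num.max w0 (ln M / d).
exists M, w; have w1 : ln M / d <= w by rewrite le_max lexx orbT.
split=> //; [| by rewrite le_max lexx |].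
  by apply: le_trans w1; rewrite divr_ge0 ?ln_ge0 // ltW.
have step n t : 0 <= t <= n.+1%:R * d -> norm_bound (M ^+ n.+1) (T t).
  elim: n t => [|n ih] t; first by rewrite mul1r expr1; exact: hM.
  move=> /andP[t0 tn]; have [td|dt] := leP t d.
    move=> f; have := hM t; rewrite t0 td => /(_ isT f)/le_trans; apply.
    by rewrite ler_wpM2r // -[X in X <= _]expr1 ler_weXn2l.
  move=> f; have td0 : 0 <= t - d by rewrite subr_ge0 ltW.
  rewrite -[t](subrK d) aT ?(ltW d0) //.
  have h1 : `|T (t - d) (T d f)| <= M ^+ n.+1 * `|T d f|.
    apply: ih; rewrite td0 /= lerBlDr; apply: le_trans tn _.
    by rewrite (_ : n.+2%:R = n.+1%:R + 1) ?mulrDl ?mul1r // -natr1.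
  apply: le_trans h1 _; rewrite [M ^+ n.+2]exprSr -mulrA.
  rewrite ler_wpM2l ?exprn_ge0 ?(ltW M0) //.
  by apply: hM; rewrite lexx ltW.
move=> t t0 f; have /andP[h1 h2] := truncn_itv (divr_ge0 t0 (ltW d0)).
set n := Num.truncn _ in h1 h2.
have /step/(_ f) : 0 <= t <= n.+1%:R * d.
  by rewrite t0 /= -ler_pdivrMr // ltW.
move=> /le_trans; apply; apply: ler_wpM2r => //; rewrite exprS.
apply: ler_wpM2l; first exact: ltW.
rewrite -[M in M ^+ _](lnK M0) -expRM_natl ler_expR.
apply: (@le_trans _ _ (t / d * ln M)).
  by apply: ler_wpM2r => //; exact: ln_ge0.
by rewrite mulrAC -mulrA mulrC ler_wpM2r.
Qed.

(** For a sublinear functional [q], the weighted supremum of [q] along orbits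
    is a sublinear functional for which [T] has growth bound [w] without any
    further constant. *)
Section WeightedSup.
Variables (T : R -> {linear E -> E}) (M w : R).
Hypothesis aT : forall s t, 0 <= s -> 0 <= t -> forall f, T (s + t) f = T s (T t f).
Hypothesis idT : forall f, T 0 f = f.
Hypotheses (M0 : 0 <= M) (w0 : 0 <= w).
Hypothesis bT : forall t, 0 <= t -> norm_bound (M * expR (w * t)) (T t).
Variable q : E -> R.
Hypothesis qD : forall f g, q (f + g) <= q f + q g.
Hypothesis qZ : forall a f, 0 < a -> q (a *: f) = a * q f.
Hypothesis q_le : forall f, q f <= `|f|.

Definition orbit_sup f : R :=
  sup [set expR (- (w * t)) * q (T t f) | t in [set t | 0 <= t]].

Lemma orbit_ub f t : 0 <= t -> expR (- (w * t)) * q (T t f) <= M * `|f|.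
Proof.
move=> t0; apply: (@le_trans _ _ (expR (- (w * t)) * (M * expR (w * t) * `|f|))).
  by rewrite ler_wpM2l ?expR_ge0 //; apply: le_trans (q_le _) _; exact: bT.
rewrite (_ : _ * _ = expR (- (w * t)) * expR (w * t) * (M * `|f|)); last by ring.
by rewrite -expRD addNr expR0 mul1r.
Qed.

Lemma orbit_sup_ge f t : 0 <= t -> expR (- (w * t)) * q (T t f) <= orbit_sup f.
Proof.
move=> t0; apply: ub_le_sup; last by exists t.
by exists (M * `|f|) => _ [s s0 <-]; exact: orbit_ub.
Qed.

Lemma orbit_sup_le f c :
  (forall t, 0 <= t -> expR (- (w * t)) * q (T t f) <= c) -> orbit_sup f <= c.
Proof.
move=> h; apply: ge_sup; last by move=> _ [s s0 <-]; exact: h.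
by exists (expR (- (w * 0)) * q (T 0 f)), 0 => /=.
Qed.

Lemma le_orbit_sup f : q f <= orbit_sup f.
Proof.
have := orbit_sup_ge f (lexx 0).
by rewrite mulr0 oppr0 expR0 mul1r idT.
Qed.

Lemma orbit_sup_norm f : orbit_sup f <= M * `|f|.
Proof. by apply: orbit_sup_le => t; exact: orbit_ub. Qed.

Lemma orbit_supD f g : orbit_sup (f + g) <= orbit_sup f + orbit_sup g.
Proof.
apply: orbit_sup_le => t t0; rewrite linearD.
apply: (@le_trans _ _ (expR (- (w * t)) * (q (T t f) + q (T t g)))).
  by rewrite ler_wpM2l ?expR_ge0.
by rewrite mulrDr; apply: lerD; exact: orbit_sup_ge.
Qed.

Lemma orbit_supZ_le a f : 0 < a -> orbit_sup (a *: f) <= a * orbit_sup f.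
Proof.
move=> a0; apply: orbit_sup_le => t t0; rewrite (linearZZ (T t)) qZ // mulrCA.
by apply: ler_wpM2l; [exact: ltW | exact: orbit_sup_ge].
Qed.

Lemma orbit_supZ a f : 0 < a -> orbit_sup (a *: f) = a * orbit_sup f.
Proof.
move=> a0; apply/eqP; rewrite eq_le orbit_supZ_le //=.
have /(orbit_supZ_le (a *: f)) : 0 < a^-1 by rewrite invr_gt0.
by rewrite scalerA mulVf ?gt_eqF // scale1r -ler_pdivrMl ?invrK // invr_gt0.
Qed.

Lemma orbit_sup_semigroup f s : 0 <= s ->
  orbit_sup (T s f) <= expR (w * s) * orbit_sup f.
Proof.
move=> s0; apply: orbit_sup_le => t t0; rewrite -aT //.
have -> : expR (- (w * t)) = expR (w * s) * expR (- (w * (t + s))).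
  by rewrite -expRD; congr expR; ring.
rewrite -mulrA; apply: ler_wpM2l; first exact: expR_ge0.
by apply: orbit_sup_ge; exact: addr_ge0.
Qed.

(** Apply the sublinear functional to
    [(1 + t l) f = T t f + t (l f - v) + o(t)], subtract [orbit_sup f], divide by
    [t] and let [t] tend to [0]. *)
Lemma generator_dissipative l f v : 0 <= l -> right_derivative T f v ->
  0 <= orbit_sup f -> (l - w) * orbit_sup f <= orbit_sup (l *: f - v).
Proof.
move=> l0 /right_derivativeP hf N0; set g := l *: f - v.
apply/ler_addgt0Pr => e' e'0; pose C := w * orbit_sup f + M + 1.
have C0 : 0 < C by rewrite /C ltr_wpDl // addr_ge0 // mulr_ge0.
pose e := e' / C; have e0 : 0 < e by rewrite divr_gt0.
have [d d0 hd] := hf e e0; have [d1 d10 hd1] := expR_le_linear w0 e0.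
pose d' := Num.min d d1; have d'0 : 0 < d' by rewrite lt_min d0.
pose t := d' / 2; have t0 : 0 < t by rewrite divr_gt0.
have td' : t < d' by rewrite ltr_pdivrMr // ltr_pMr // ltr1n.
move: td'; rewrite lt_min => /andP[td td1].
have /hd h1 : 0 < t < d by rewrite t0.
have hexp : expR (w * t) <= 1 + w * t * (1 + e) by apply: hd1; rewrite t0.
have a0 : 0 < 1 + t * l by rewrite ltr_wpDr // mulr_ge0 // ltW.
have key : (1 + t * l) * orbit_sup f <=
    expR (w * t) * orbit_sup f + t * orbit_sup g + t * (M * e).
  rewrite -orbit_supZ //.
  have -> : (1 + t * l) *: f = T t f + t *: g +
      t *: (v - t^-1 *: (T t f - f)).
    by rewrite /g; lmod_coefs R E => //; field; rewrite gt_eqF.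
  apply: le_trans (orbit_supD _ _) _; apply: lerD.
    apply: le_trans (orbit_supD _ _) _; apply: lerD.
      exact/orbit_sup_semigroup/ltW.
    by rewrite orbit_supZ.
  rewrite orbit_supZ // ler_pM2l //; apply: le_trans (orbit_sup_norm _) _.
  exact: ler_wpM2l.
have k2 : t * ((l - w) * orbit_sup f) <=
    t * (orbit_sup g + e * (w * orbit_sup f + M)).
  have : expR (w * t) * orbit_sup f <= (1 + w * t * (1 + e)) * orbit_sup f.
    exact: ler_wpM2r.
  by lra.
move: k2; rewrite ler_pM2l // => /le_trans; apply; rewrite lerD2l.
rewrite (_ : e' = e * C); last by rewrite /e divfK // gt_eqF.
by rewrite ler_pM2l // /C lerDl.
Qed.

End WeightedSup.

Section Dissipativity.
Variables (T : R -> {linear E -> E}) (M w : R).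
Hypothesis aT : forall s t, 0 <= s -> 0 <= t -> forall f, T (s + t) f = T s (T t f).
Hypothesis idT : forall f, T 0 f = f.
Hypotheses (M0 : 0 <= M) (w0 : 0 <= w).
Hypothesis bT : forall t, 0 <= t -> norm_bound (M * expR (w * t)) (T t).

Let N := orbit_sup T w (fun f => `|f|).

Let nZ a (f : E) : 0 < a -> `|a *: f| = a * `|f|.
Proof. by move=> a0; rewrite normrZ gtr0_norm. Qed.

Let nle (f : E) : `|f| <= `|f|.
Proof. exact: lexx. Qed.

Let le_N f : `|f| <= N f.
Proof. exact: (le_orbit_sup idT bT nle). Qed.

Let N_le f : N f <= M * `|f|.
Proof. exact: (orbit_sup_norm (q := fun f => `|f|) bT nle). Qed.

Let N_ge0 f : 0 <= N f.
Proof. exact: le_trans (le_N f). Qed.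

Let N_dissipative l f v : 0 <= l -> right_derivative T f v ->
  (l - w) * N f <= N (l *: f - v).
Proof.
move=> l0 hf.
exact: (generator_dissipative aT M0 w0 bT (@ler_normD _ _) nZ nle l0 hf
  (N_ge0 f)).
Qed.

Lemma generator_injective l f v : w < l -> right_derivative T f v ->
  l *: f - v = 0 -> f = 0.
Proof.
move=> wl hf e0; have l0 : 0 <= l by exact/ltW/(le_lt_trans w0).
have := N_dissipative l0 hf; rewrite e0.
have := N_le 0; rewrite normr0 mulr0 => h1 h2; have := le_trans h2 h1.
rewrite pmulr_rle0 ?subr_gt0 // => h3.
by apply/eqP; rewrite -normr_le0; exact: le_trans (le_N f) h3.
Qed.

(** In the norm [N], which is equivalent to the given one, [(l - w) P] is a
    contraction. *)
Lemma resolvent_power_bound A l P n : generates A T -> w < l ->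
  resolvent_of A l P -> norm_bound M (iter n (fun f => (l - w) *: P f)).
Proof.
move=> hA wl hP f; have l0 : 0 <= l by exact/ltW/(le_lt_trans w0).
apply: le_trans (le_N _) _.
suff h : N (iter n (fun f => (l - w) *: P f) f) <= N f.
  exact: le_trans h (N_le f).
elim: n => //= n; apply: le_trans; set g := iter _ _ _.
have hg : right_derivative T (P g) (A (P g)).
  by apply/(generatesP hA); split=> //; exact: resolvent_dom hP.
have := N_dissipative l0 hg; rewrite (resolvent_eq _ hP); apply: le_trans.
by rewrite /N (orbit_supZ (q := fun f => `|f|) bT nZ nle) // subr_gt0.
Qed.

End Dissipativity.

End SemigroupTheory.

(** The sublinear functional [`|vneg f|] vanishes exactly on the cone, so that
    dissipativity turns [g >= 0] into [(l - A)^-1 g >= 0]. *)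
Lemma generator_resolvent_positive (R : realType) (E : banachLatticeType R)
    (T : R -> {linear E -> E}) (A : operator E E) (M w l : R)
    (P : {linear E -> E}) :
  generates A T -> positive_semigroup T -> 0 <= M -> 0 <= w ->
  (forall t, 0 <= t -> norm_bound (M * expR (w * t)) (T t)) ->
  w < l -> resolvent_of A l P -> positive_op P.
Proof.
move=> hA hT M0 w0 bT wl hP g g0; have [_ idT aT _] := hA.1.
pose q (f : E) : R := `|vneg f|; pose N := orbit_sup T w q.
have qle f : q f <= `|f| by exact: vneg_norm.
have qD f h : q (f + h) <= q f + q h.
  apply: le_trans (ler_normD _ _); apply: vnorm_le_pos (vnegD _ _).
  exact: vneg_ge0.
have qZ a f : 0 < a -> q (a *: f) = a * q f.
  by move=> a0; rewrite /q vnegZ // normrZ gtr0_norm.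
have leN f : q f <= N f by exact: (le_orbit_sup idT bT qle).
have l0 : 0 <= l by exact/ltW/(le_lt_trans w0).
have hf : right_derivative T (P g) (A (P g)).
  by apply/(generatesP hA); split=> //; exact: resolvent_dom hP.
have Nf0 : 0 <= N (P g) by apply: le_trans (leN _); exact: normr_ge0.
have := generator_dissipative aT M0 w0 bT qD qZ qle l0 hf Nf0.
rewrite (resolvent_eq _ hP) => h.
have h0 : N g <= 0.
  apply: orbit_sup_le => t t0.
  rewrite /q vneg_pos ?normr0 ?mulr0 //; exact: hT.
apply: vneg_eq0; apply/eqP; rewrite -normr_le0; apply: le_trans (leN _) _.
by rewrite -(pmulr_rle0 _ (_ : 0 < l - w)) ?subr_gt0 //; exact: le_trans h h0.
Qed.

(** * Generation by Euler's implicit scheme *)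

Section LinearIterates.
Variables (R : realType) (E : normedModType R) (P : {linear E -> E}).

Lemma iter_linear n : linear (iter n P).
Proof. by elim: n => // n ih a f g; rewrite !iterS ih linearP. Qed.

Lemma iter_linearD n f g : iter n P (f + g) = iter n P f + iter n P g.
Proof. by have := iter_linear n 1 f g; rewrite !scale1r. Qed.

Lemma iter_linear0 n : iter n P 0 = 0.
Proof. by elim: n => // n ih; rewrite iterS ih linear0. Qed.

Lemma iter_linearZ n a f : iter n P (a *: f) = a *: iter n P f.
Proof. by have := iter_linear n a f 0; rewrite iter_linear0 !addr0. Qed.

Lemma iter_linearB n f g : iter n P (f - g) = iter n P f - iter n P g.
Proof. by rewrite iter_linearD -scaleN1r iter_linearZ scaleN1r. Qed.

End LinearIterates.

Lemma trunc_add (R : archiRealDomainType) (x y : R) : 0 <= x -> 0 <= y ->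
  exists b : bool, Num.truncn (x + y) = (Num.truncn x + Num.truncn y + b)%N.
Proof.
move=> x0 y0; have /andP[x1 x2] := truncn_itv x0; have /andP[y1 y2] := truncn_itv y0.
have h (b : bool) : (Num.truncn x + Num.truncn y + b)%:R <= x + y <
    (Num.truncn x + Num.truncn y + b).+1%:R ->
  exists b : bool, Num.truncn (x + y) = (Num.truncn x + Num.truncn y + b)%N.
  by move=> hb; exists b; exact: truncn_def.
rewrite -natr1 in x2; rewrite -natr1 in y2.
have [lt1|ge1] := ltP (x + y) (Num.truncn x + Num.truncn y + 1)%:R.
  by apply: (h false); rewrite addn0 -addn1 lt1 natrD lerD.
apply: (h true); rewrite ge1 /= -natr1 !natrD.
by have := ltrD x2 y2; rewrite !addrA; lra.
Qed.

(** [J h] is [(1 - h C)^-1], the step of length [h] of the implicit Euler scheme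
    for [f' = C f]. *)
Section Euler.
Variables (R : realType) (E : completeNormedModType R) (C : operator E E).
Variables (J : R -> {linear E -> E}) (M : R).
Hypothesis hJ : forall h, 0 < h ->
  forall f g, (dom C f /\ f - h *: C f = g) <-> f = J h g.
Hypothesis M1 : 1 <= M.
Hypothesis hM : forall h n, 0 < h -> norm_bound M (iter n (J h)).
Hypothesis hD : forall f e, 0 < e -> exists2 g, dom C g & `|f - g| <= e.
Implicit Types (f g : E) (h t e : R).

Let M0 : 0 <= M. Proof. exact: le_trans M1. Qed.

Let J_dom h g : 0 < h -> dom C (J h g).
Proof. by move=> h0; have [] := (hJ h0 (J h g) g).2 erefl. Qed.

Let J_step h f : 0 < h -> dom C f -> J h f = f + h *: J h (C f).
Proof.
move=> h0 df; have /(hJ h0) e : dom C f /\ f - h *: C f = f - h *: C f by [].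
by rewrite {2}e linearB linearZZ subrK.
Qed.

Let J_comm h f : 0 < h -> dom C f -> C (J h f) = J h (C f).
Proof.
move=> h0 df; have [_ e] := (hJ h0 (J h f) f).2 erefl.
have : h *: C (J h f) = h *: J h (C f).
  have -> : h *: C (J h f) = J h f - f by rewrite -{3}e; lmod R E.
  by rewrite (J_step h0 df); lmod R E.
by move/(congr1 (fun x => h^-1 *: x)); rewrite !scalerA mulVf ?gt_eqF // !scale1r.
Qed.

Let iter_dom n h f : 0 < h -> dom C f ->
  dom C (iter n (J h) f) /\ C (iter n (J h) f) = iter n (J h) (C f).
Proof.
move=> h0 df; elim: n => // n [d e] /=; split; first exact: J_dom.
by rewrite J_comm // e.
Qed.

Let iter_dist n h f : 0 < h -> dom C f ->
  `|iter n (J h) f - f| <= n%:R * h * (M * `|C f|).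
Proof.
move=> h0 df; elim: n => [|n ih]; first by rewrite subrr normr0 !mul0r.
rewrite iterSr J_step // iter_linearD iter_linearZ -iterSr addrAC.
apply: le_trans (ler_normD _ _) _; rewrite -natr1 2!mulrDl mul1r.
by apply: lerD => //; rewrite normrZ gtr0_norm // ler_wpM2l ?(ltW h0) //; exact: (hM n.+1).
Qed.

(** [iter_dist] controls the scheme on the domain only; the uniform bound [M] and
    density extend the control to every [f], uniformly in [h]. *)
Let iter_approx f e : 0 < e -> exists2 d, 0 < d &
  forall h n, 0 < h -> n%:R * h <= d -> `|iter n (J h) f - f| <= e.
Proof.
move=> e0; have a0 : 0 < 2 * (M + 1) by rewrite mulr_gt0 // ltr_wpDl.
have [g dg fg] := hD f (divr_gt0 e0 a0).
pose c := M * `|C g| + 1; have c0 : 0 < c by rewrite ltr_wpDl // mulr_ge0.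
exists (e / (2 * c)); first by rewrite divr_gt0 // mulr_gt0.
move=> h n h0 hn; have -> : iter n (J h) f - f =
    iter n (J h) (f - g) + (iter n (J h) g - g) - (f - g).
  by rewrite iter_linearB; lmod R E.
apply: le_trans (ler_normB _ _) _.
have h1 : `|iter n (J h) (f - g)| <= M * `|f - g| by exact: hM.
have h2 : `|iter n (J h) g - g| <= e / 2.
  apply: le_trans (iter_dist n h0 dg) _.
  apply: (@le_trans _ _ (e / (2 * c) * c)).
    by apply: ler_pM => //; rewrite ?mulr_ge0 // ?(ltW h0) // /c lerDl.
  by rewrite (_ : e / (2 * c) * c = e / 2) //; field; rewrite gt_eqF.
have h3 : (M + 1) * `|f - g| <= e / 2.
  have := ler_wpM2l (addr_ge0 M0 ler01) fg.
  by rewrite (_ : _ * (e / _) = e / 2) //; field; rewrite gt_eqF // ltr_wpDl.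
have := ler_normD (iter n (J h) (f - g)) (iter n (J h) g - g).
by lra.
Qed.

(** [1 - 2 k C] and [(1 - k C)^2] differ by [(k C)^2] only. *)
Let halving_step k f : 0 < k -> dom C f -> dom C (C f) ->
  `|J (2 * k) f - J k (J k f)| <= 8 * k ^+ 2 * (M * `|C (C f)|).
Proof.
move=> k0 df dcf; set c := C f; set b := M * _; have b0 : 0 <= b by rewrite mulr_ge0.
have k20 : 0 < 2 * k by rewrite mulr_gt0.
have -> : J (2 * k) f - J k (J k f) =
    k *: ((J (2 * k) c - c) + (J (2 * k) c - c) - (J k c - c) - (J k (J k c) - c)).
  have e2 := J_step k0 df; rewrite -/c in e2.
  rewrite (J_step k20 df) -/c {1}e2 linearD linearZZ e2; lmod R E.
have h1 := iter_dist 1 k20 dcf; have h2 := iter_dist 1 k0 dcf.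
have h3 := iter_dist 2 k0 dcf; rewrite -/c -/b /= in h1 h2 h3.
rewrite normrZ gtr0_norm // expr2.
have -> : 8 * (k * k) * b = k * (8 * k * b) by ring.
rewrite ler_pM2l //; apply: le_trans (ler_normB _ _) _.
have := ler_normB (J (2 * k) c - c + (J (2 * k) c - c)) (J k c - c).
have := ler_normD (J (2 * k) c - c) (J (2 * k) c - c).
have : 0 <= k * b by rewrite mulr_ge0 // ltW.
lra.
Qed.

(** [X^n - Y^n] is the sum of the [X^(n - 1 - i) (X - Y) Y^i]. *)
Let telescope (X : {linear E -> E}) (Y : E -> E) f n e :
  (forall i, norm_bound M (iter i X)) ->
  (forall i, `|X (iter i Y f) - Y (iter i Y f)| <= e) ->
  `|iter n X f - iter n Y f| <= n%:R * (M * e).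
Proof.
move=> hX; elim: n f => [|n ih] f he; first by rewrite subrr normr0 mul0r.
have -> : iter n.+1 X f - iter n.+1 Y f =
    (iter n X (Y f) - iter n Y (Y f)) + iter n X (X f - Y f).
  by rewrite iter_linearB !iterSr; lmod R E.
apply: le_trans (ler_normD _ _) _; rewrite -natr1 mulrDl mul1r; apply: lerD.
  by apply: ih => i; have := he i.+1; rewrite iterSr.
by apply: le_trans (hX n _) _; apply: ler_wpM2l => //; exact: (he 0%N).
Qed.

(* Dyadic steps make each scheme comparable to the next one by [halving_step]. *)
Let step (k : nat) : R := 2 ^- k.

Let step_gt0 k : 0 < step k. Proof. by rewrite invr_gt0 exprn_gt0. Qed.

Let stepS k : step k = 2 * step k.+1.
Proof. by rewrite /step exprS invfM mulrA mulfV // mul1r. Qed.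

Let step_small e : 0 < e -> exists N, forall k, (N <= k)%N -> step k < e.
Proof.
move=> e0; exists (Num.truncn e^-1) => k kN.
rewrite -[e]invrK ltf_pV2 ?posrE ?invr_gt0 ?exprn_gt0 //.
apply: lt_le_trans (truncnS_gt _) _; rewrite -natrX ler_nat.
by apply: leq_ltn_trans kN _; exact: ltn_expl.
Qed.

Let steps (k : nat) t : nat := Num.truncn (t / step k).

Let scheme k t f : E := iter (steps k t) (J (step k)) f.

Let steps_neg k t : t < 0 -> steps k t = 0%N.
Proof.
move=> t0; rewrite /steps truncn_floor ifF //; apply/negbTE.
by rewrite -ltNge pmulr_llt0 // invr_gt0.
Qed.

Let steps_le k t : (steps k t)%:R * step k <= `|t|.
Proof.
have [t0|t0] := leP 0 t.
  rewrite ger0_norm // -ler_pdivlMr //.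
  by rewrite /steps truncn_le divr_ge0 // ltW.
by rewrite steps_neg // mul0r.
Qed.

Let steps_ge k t : 0 <= t -> t - step k <= (steps k t)%:R * step k.
Proof.
move=> t0; have /andP[_] := truncn_itv (divr_ge0 t0 (ltW (step_gt0 k))).
by rewrite ltr_pdivrMr // -natr1 mulrDl mul1r => h; rewrite lerBlDr ltW.
Qed.

Let steps_double k t : exists b : bool, steps k.+1 t = ((steps k t).*2 + b)%N.
Proof.
have [t0|t0] := leP 0 t.
  have e : t / step k.+1 = t / step k + t / step k.
    by rewrite (stepS k); field; rewrite gt_eqF.
  have h0 : 0 <= t / step k by rewrite divr_ge0 // ltW.
  by have [b hb] := trunc_add h0 h0; exists b; rewrite /steps e hb addnn.
by exists false; rewrite !steps_neg.
Qed.

Let off_by_one n (b : bool) h f : 0 < h ->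
  `|iter (n + b) (J h) f - iter n (J h) f| <= M * `|J h f - f|.
Proof.
move=> h0; case: b; last by rewrite addn0 subrr normr0 mulr_ge0.
by rewrite addn1 iterSr -iter_linearB; exact: hM.
Qed.

(** Halving the step doubles the number of steps, up to one additional step. *)
Let scheme_halving k t f : dom C f -> dom C (C f) ->
  `|scheme k t f - scheme k.+1 t f| <=
  (2 * `|t| * M ^+ 3 * `|C (C f)| + M ^+ 2 * `|C f|) * step k.
Proof.
move=> df dcf; have [b eb] := steps_double k t; set n := steps k t in eb *.
pose h := step k.+1; have h0 : 0 < h by exact: step_gt0.
rewrite /scheme eb -/h -/n (stepS k) -/h.
have -> : iter n (J (2 * h)) f - iter (n.*2 + b) (J h) f =
    (iter n (J (2 * h)) f - iter n (fun g => J h (J h g)) f) -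
    (iter (n.*2 + b) (J h) f - iter n.*2 (J h) f).
  have -> : iter n (fun g => J h (J h g)) f = iter n.*2 (J h) f.
    by elim: (n) => //= m ->.
  by lmod R E.
apply: le_trans (ler_normB _ _) _; rewrite [X in _ <= X]mulrDl; apply: lerD.
  have h20 : 0 < 2 * h by rewrite mulr_gt0.
  apply: le_trans (telescope (e := 8 * h ^+ 2 * (M * (M * `|C (C f)|))) n _ _) _.
  - by move=> i; exact: hM.
  - move=> i; have -> : iter i (fun g => J h (J h g)) f = iter i.*2 (J h) f.
      by elim: (i) => //= m ->.
    have [d1 e1] := iter_dom i.*2 h0 df; have [d2 e2] := iter_dom i.*2 h0 dcf.
    apply: le_trans (halving_step h0 d1 _) _; first by rewrite e1.
    apply: ler_wpM2l; first by rewrite mulr_ge0 // sqr_ge0.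
    by rewrite e1 e2; apply: ler_wpM2l => //; exact: hM.
  - have := steps_le k t; rewrite -/n (stepS k) -/h => hn.
    have c0 : 0 <= 4 * h * (M ^+ 3 * `|C (C f)|).
      by rewrite mulr_ge0 ?mulr_ge0 ?exprn_ge0 // ltW.
    have := ler_wpM2l c0 hn; congr (_ <= _); ring.
apply: le_trans (off_by_one _ _ _ h0) _; rewrite J_step // addrAC subrr add0r.
rewrite normrZ gtr0_norm //.
have h1 : `|J h (C f)| <= M * `|C f| by exact: (hM 1).
have h2 : M * (h * `|J h (C f)|) <= M * (h * (M * `|C f|)).
  by rewrite ler_wpM2l // ler_wpM2l // ltW.
apply: le_trans h2 _; rewrite -subr_ge0.
rewrite (_ : _ - _ = h * (M ^+ 2 * `|C f|)); last by ring.
by rewrite mulr_ge0 ?mulr_ge0 ?exprn_ge0 // ltW.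
Qed.

Let scheme_cauchy t f : dom C f -> dom C (C f) -> exists2 a, 0 <= a &
  forall k m, (k <= m)%N -> `|scheme k t f - scheme m t f| <= a * step k.
Proof.
move=> df dcf; pose a := 2 * `|t| * M ^+ 3 * `|C (C f)| + M ^+ 2 * `|C f|.
have a0 : 0 <= a by rewrite addr_ge0 ?mulr_ge0 ?exprn_ge0.
exists (2 * a); first by rewrite mulr_ge0.
move=> k m km; apply: (@le_trans _ _ (2 * a * (step k - step m))); last first.
  by rewrite ler_wpM2l ?mulr_ge0 // gerBl ltW.
elim: m km => [|m ih]; first by rewrite leqn0 => /eqP ->; rewrite !subrr normr0 mulr0.
rewrite leq_eqVlt => /orP[/eqP ->|]; first by rewrite !subrr normr0 mulr0.
rewrite ltnS => /ih{}ih; have := scheme_halving m t df dcf; rewrite -/a => h.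
have := ler_distD (scheme m t f) (scheme k t f) (scheme m.+1 t f).
by move: h ih; rewrite (stepS m); lra.
Qed.

Let D2_dense f e : 0 < e ->
  exists g, [/\ dom C g, dom C (C g) & `|f - g| <= e].
Proof.
move=> e0; have e20 : 0 < e / 2 by rewrite divr_gt0.
have [g dg fg] := hD f e20; have [d d0 hd] := iter_approx g e20.
exists (J d g); split; first exact: J_dom.
  by rewrite J_comm //; exact: J_dom.
have := hd d 1%N d0; rewrite mul1r /= distrC => /(_ (lexx _)) h.
by have := ler_distD g f (J d g); lra.
Qed.

Let scheme_cvg t f : cvgn (fun k => scheme k t f).
Proof.
apply: cvg_of_approximants => e e0.
have e1 : 0 < e / (2 * M) by rewrite divr_gt0 // mulr_gt0 // (lt_le_trans _ M1).
have [g [dg dcg fg]] := D2_dense f e1.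
have [a a0 ha] := scheme_cauchy t dg dcg.
have [|N hN] := step_small (e := e / (2 * (a + 1))).
  by rewrite divr_gt0 // mulr_gt0 // ltr_wpDl.
exists (scheme N t g), N => //= m Nm.
have h1 : `|scheme m t g - scheme m t f| <= e / 2.
  rewrite /scheme -iter_linearB distrC in fg *; apply: le_trans (hM _ _ _) _ => //.
  have := ler_wpM2l M0 fg.
  rewrite (_ : M * (e / (2 * M)) = e / 2) ?(distrC f) //.
  by field; rewrite gt_eqF // (lt_le_trans _ M1).
have h2 : `|scheme N t g - scheme m t g| < e / 2.
  apply: le_lt_trans (ha _ _ Nm) _.
  apply: (@le_lt_trans _ _ ((a + 1) * step N)).
    by rewrite ler_wpM2r ?lerDl // ltW.
  have := hN N (leqnn _); rewrite -(ltr_pM2l (_ : 0 < a + 1)) ?ltr_wpDl //.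
  rewrite (_ : (a + 1) * (e / (2 * (a + 1))) = e / 2) //.
  by field; rewrite gt_eqF // ltr_wpDl.
by have := ler_distD (scheme m t g) (scheme N t g) (scheme m t f); lra.
Qed.

Let limit t f : E := limn (fun k => scheme k t f).

Let limitP t f e : 0 < e -> exists N, forall k, (N <= k)%N ->
  `|limit t f - scheme k t f| <= e.
Proof.
move=> e0; have /cvgrPdist_le/(_ e e0)[N _ hN] := @scheme_cvg t f.
by exists N => k kN; exact: hN.
Qed.

Let limit_linear t : linear (limit t).
Proof.
move=> a f g; apply: cvg_lim => //.
have -> : (fun k => scheme k t (a *: f + g)) =
    (fun k => a *: scheme k t f + scheme k t g).
  by apply/funext => k; exact: iter_linear.
by apply: cvgD; [apply: cvgZr |]; exact: scheme_cvg.
Qed.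

Let limit_le t f g (c : R) : (exists N, forall k, (N <= k)%N ->
  `|scheme k t f - g| <= c) -> `|limit t f - g| <= c.
Proof.
move=> [N1 h1]; apply/ler_addgt0Pr => e e0; have [N2 h2] := limitP t f e0.
have := ler_distD (scheme (maxn N1 N2) t f) (limit t f) g.
have := h1 _ (leq_maxl N1 N2); have := h2 _ (leq_maxr N1 N2).
lra.
Qed.

(** The schemes converge on the dense set [dom (C^2)], with error of the order of
    the step, hence everywhere by the bound [M]. The semigroup law holds for the
    schemes up to one step, and
    [J h ^ n f - f = h * \sum_(1 <= i <= n) J h ^ i (C f)] gives the
    derivative at [0]. *)
Theorem euler_semigroup : exists S : R -> {linear E -> E},
  [/\ C0_semigroup S, forall t, norm_bound M (S t),
      forall f, dom C f -> right_derivative S f (C f) &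
      forall t f e, 0 < e -> exists h n, 0 < h /\
        `|S t f - iter n (J h) f| <= e].
Proof.
have /choice[S hS] t := linear_bundle (@limit_linear t).
have bS t : norm_bound M (S t).
  move=> f; rewrite hS -[limit t f]subr0; apply: limit_le; exists 0%N => k _.
  by rewrite subr0; exact: hM.
exists S; split=> //; last first.
- move=> t f e e0; have [N hN] := limitP t f e0.
  by exists (step N), (steps N t); split=> //; rewrite hS; exact: hN.
- move=> f df; apply/right_derivativeP => e e0.
  have [d d0 hd] := iter_approx (C f) e0; exists d => // t /andP[t0 td].
  have main h n : 0 < h -> n%:R * h <= d ->
      `|iter n (J h) f - f - (n%:R * h) *: C f| <= n%:R * h * e.
    move=> h0; elim: n => [|n ih] hn.
      by rewrite !mul0r scale0r subr0 subrr normr0.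
    rewrite iterSr J_step // iter_linearD iter_linearZ -iterSr.
    have -> : iter n (J h) f + h *: iter n.+1 (J h) (C f) - f -
        (n.+1%:R * h) *: C f = (iter n (J h) f - f - (n%:R * h) *: C f) +
        h *: (iter n.+1 (J h) (C f) - C f).
      by rewrite -natr1; lmod R E.
    apply: le_trans (ler_normD _ _) _; rewrite -natr1 2!mulrDl mul1r.
    apply: lerD.
      by apply: ih; apply: le_trans hn; rewrite ler_wpM2r ?(ltW h0) // ler_nat.
    by rewrite normrZ gtr0_norm // ler_wpM2l ?(ltW h0) //; exact: hd.
  have h1 : `|S t f - (f + t *: C f)| <= t * e.
    rewrite hS; apply/ler_addgt0Pr => e' e'0.
    have [|N hN] := step_small (e := e' / (`|C f| + 1)).
      by rewrite divr_gt0 // ltr_wpDl.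
    apply: limit_le; exists N => k kN.
    have hk := steps_le k t; rewrite gtr0_norm // in hk.
    have m := main _ (steps k t) (step_gt0 k) (le_trans hk (ltW td)).
    have -> : scheme k t f - (f + t *: C f) =
        (scheme k t f - f - ((steps k t)%:R * step k) *: C f) -
        (t - (steps k t)%:R * step k) *: C f by lmod R E.
    apply: le_trans (ler_normB _ _) _; apply: lerD.
      by apply: le_trans m _; rewrite ler_wpM2r // ltW.
    rewrite normrZ ger0_norm ?subr_ge0 //.
    have := steps_ge k (ltW t0) => h1.
    have h2 : t - (steps k t)%:R * step k <= e' / (`|C f| + 1).
      by have := hN k kN; lra.
    have := ler_wpM2r (normr_ge0 (C f)) h2; move/le_trans; apply.
    have : e' / (`|C f| + 1) * `|C f| <= e' / (`|C f| + 1) * (`|C f| + 1).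
      by rewrite ler_wpM2l ?lerDl // divr_ge0 // ltW // ltr_wpDl.
    by rewrite divfK // gt_eqF // ltr_wpDl.
  have -> : C f - t^-1 *: (S t f - f) = - (t^-1 *: (S t f - (f + t *: C f))).
    by lmod_coefs R E => //; field; rewrite gt_eqF.
  by rewrite normrN normrZ gtr0_norm ?invr_gt0 // ler_pdivrMl.
split.
- by move=> t _; exact: norm_bound_continuous (bS t).
- move=> f; rewrite hS; apply: cvg_lim => //.
  rewrite (_ : (fun _ => _) = fun=> f); first exact: cvg_cst.
  by apply/funext => k; rewrite /scheme /steps mul0r truncn0.
- move=> s t s0 t0 f; apply/eqP; rewrite -subr_eq0 -normr_le0.
  apply/ler_addgt0Pr => e e0; rewrite add0r.
  pose e' := e / (2 * (M + 1)).
  have e'0 : 0 < e' by rewrite divr_gt0 // mulr_gt0 // ltr_wpDl.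
  have [N1 h1] := limitP (s + t) f e'0.
  have [N2 h2] := limitP t f e'0.
  have [N3 h3] := limitP s (limit t f) e'0.
  have [d d0 hd] := iter_approx f e'0.
  have [N4 h4] := step_small d0.
  pose k := maxn (maxn N1 N2) (maxn N3 N4).
  have kN1 : (N1 <= k)%N by rewrite !leq_max leqnn.
  have kN2 : (N2 <= k)%N by rewrite !leq_max leqnn orbT.
  have kN3 : (N3 <= k)%N by rewrite !leq_max leqnn !orbT.
  have kN4 : (N4 <= k)%N by rewrite !leq_max leqnn !orbT.
  rewrite !hS; set x := limit t f in h2 h3 *.
  have {}h1 := h1 k kN1; have {}h2 := h2 k kN2; have {}h3 := h3 k kN3.
  have {hd} h5 : `|J (step k) f - f| <= e'.
    by apply: (hd (step k) 1%N) => //; rewrite mul1r ltW // h4.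
  have h6 : `|scheme k (s + t) f - scheme k s (scheme k t f)| <= M * e'.
    have q0 u : 0 <= u -> 0 <= u / step k by move=> u0; rewrite divr_ge0 // ltW.
    have [b eb] := trunc_add (q0 _ s0) (q0 _ t0); rewrite -mulrDl in eb.
    rewrite /scheme {1}/steps eb -/(steps k s) -/(steps k t) -iterD.
    apply: le_trans (off_by_one _ _ _ (step_gt0 k)) _; exact: ler_wpM2l.
  have h7 : `|scheme k s x - scheme k s (scheme k t f)| <= M * e'.
    rewrite /scheme -iter_linearB; apply: le_trans (hM _ _ _) _ => //.
    exact: ler_wpM2l.
  have -> : limit (s + t) f - limit s x = (limit (s + t) f - scheme k (s + t) f) +
      (scheme k (s + t) f - scheme k s (scheme k t f)) -
      (scheme k s x - scheme k s (scheme k t f)) - (limit s x - scheme k s x).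
    by lmod R E.
  apply: le_trans (ler_normB _ _) _.
  have := ler_normB ((limit (s + t) f - scheme k (s + t) f) +
      (scheme k (s + t) f - scheme k s (scheme k t f)))
      (scheme k s x - scheme k s (scheme k t f)).
  have := ler_normD (limit (s + t) f - scheme k (s + t) f)
      (scheme k (s + t) f - scheme k s (scheme k t f)).
  have : 2 * (M * e') + 2 * e' = e.
    by rewrite /e'; field; rewrite gt_eqF // ltr_wpDl.
  lra.
- move=> f; apply/cvgrPdist_le => e e0; apply/near_right0.
  have [d d0 hd] := iter_approx f e0; exists d => // t /andP[t0 td].
  rewrite distrC hS; apply: limit_le; exists 0%N => k _; apply: hd => //.
  by apply: le_trans (steps_le k t) _; rewrite gtr0_norm // ltW.
Qed.

End Euler.

Section HilleYosida.
Variables (R : realType) (E : completeNormedModType R).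

(** Multiplying a semigroup by [expR (w * t)] adds [w] to its generator. *)
Lemma right_derivative_shift (S : R -> {linear E -> E}) (S' : R -> {linear E -> E})
    (w : R) (f v : E) : 0 <= w ->
  (forall t, S' t f = expR (w * t) *: S t f) ->
  S t f @[t --> 0^'+] --> f ->
  right_derivative S f v -> right_derivative S' f (v + w *: f).
Proof.
move=> w0 eS cS hf.
have cw : (expR (w * t) - 1) / t @[t --> 0^'+] --> w.
  apply/cvgrPdist_le => e e0; apply/near_right0.
  pose e' := e / (w + 1); have w1 : 0 < w + 1 by rewrite ltr_wpDl.
  have e'0 : 0 < e' by rewrite divr_gt0.
  have we : w * e' <= e.
    by rewrite /e' mulrA ler_pdivrMr // mulrDr mulr1 mulrC lerDl ltW.
  have [d d0 hd] := expR_le_linear w0 e'0; exists d => // t td.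
  have t0 : 0 < t by case/andP: td.
  have h1 := hd t td; have h2 := expR_ge1Dx (w * t).
  have h3 : w <= (expR (w * t) - 1) / t by rewrite ler_pdivlMr //; lra.
  have h4 : (expR (w * t) - 1) / t <= w * (1 + e').
    by rewrite ler_pdivrMr // -mulrA [(1 + _) * t]mulrC mulrA; lra.
  by rewrite distrC ger0_norm ?subr_ge0 //; lra.
rewrite /right_derivative (_ : (fun t => _) =
    (fun t => t^-1 *: (S t f - f) + ((expR (w * t) - 1) / t) *: S t f)).
  by apply: cvgD => //; exact: cvgZ.
by apply/funext => t; rewrite eS; lmod R E.
Qed.

(** After subtraction of [w] the resolvents satisfy the hypotheses of
    [euler_semigroup]. The generator of the semigroup extends [C], and equals it
    as [l - C] is onto while [l - generator S] is one-to-one for large [l]. The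
    approximation by powers of resolvents is recorded so that closed cones
    invariant under the resolvents are seen to be invariant under the semigroup. *)
Theorem hille_yosida (C : operator E E) (P : R -> {linear E -> E}) (w M : R) :
  0 <= w -> 1 <= M ->
  (forall l, w < l -> resolvent_of C l (P l)) ->
  (forall l n, w < l -> norm_bound M (iter n (fun f => (l - w) *: P l f))) ->
  (forall f e, 0 < e -> exists2 g, dom C g & `|f - g| <= e) ->
  exists S, generates C S /\
    forall t f e, 0 < e -> exists l n, w < l /\
      `|S t f - expR (w * t) *: iter n (fun f => (l - w) *: P l f) f| <= e.
Proof.
move=> w0 M1 hP hM hD; have M0 : 0 <= M by exact: le_trans M1.
have /choice[J hJ] : forall h : R, exists J : {linear E -> E},
    J =1 (fun f => h^-1 *: P (w + h^-1) f).
  move=> h; apply: linear_bundle => a f g.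
  by rewrite linearP; lmod R E.
pose C0 : operator E E := Operator (dom C) (fun f => C f - w *: f).
have hJ0 h : 0 < h ->
    forall f g, (dom C0 f /\ f - h *: C0 f = g) <-> f = J h g.
  move=> h0 f g; have wl : w < w + h^-1 by rewrite ltrDl invr_gt0.
  rewrite hJ -linearZZ -(hP _ wl); split=> -[df e]; split=> //.
    by rewrite -e /=; lmod_coefs R E => //; field; rewrite gt_eqF.
  have hV : h * h^-1 = 1 by rewrite mulfV // gt_eqF.
  rewrite -[g]scale1r -hV -scalerA -e /=.
  by lmod_coefs R E => //; field; rewrite gt_eqF.
have eJ h n f : iter n (J h) f =
    iter n (fun f => (w + h^-1 - w) *: P (w + h^-1) f) f.
  by apply: eq_iter => g; rewrite hJ addrAC subrr add0r.
have hM0 h n : 0 < h -> norm_bound M (iter n (J h)).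
  by move=> h0 f; rewrite eJ; apply: hM; rewrite ltrDl invr_gt0.
have [S0 [[cS0 idS0 aS0 sS0] bS0 dS0 apS0]] :=
  euler_semigroup hJ0 M1 hM0 (hD : forall f e, 0 < e -> exists2 g, dom C0 g & _).
have /choice[S hS] : forall t : R, exists S : {linear E -> E},
    S =1 (fun f => expR (w * t) *: S0 t f).
  by move=> t; apply: linear_bundle => a f g; rewrite linearP; lmod R E.
have idS f : S 0 f = f by rewrite hS mulr0 expR0 scale1r idS0.
have aS s t : 0 <= s -> 0 <= t -> forall f, S (s + t) f = S s (S t f).
  move=> s_0 t_0 f; rewrite !hS aS0 // linearZZ scalerA -expRD.
  by congr (expR _ *: _); ring.
have bS t : 0 <= t -> norm_bound (M * expR (w * t)) (S t).
  move=> t0 f; rewrite hS normrZ gtr0_norm ?expR_gt0 // (mulrC M) -mulrA.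
  by rewrite ler_wpM2l ?expR_ge0 //; exact: bS0.
have dS f : dom C f -> right_derivative S f (C f).
  move=> df; have -> : C f = (C f - w *: f) + w *: f by rewrite subrK.
  by apply: right_derivative_shift (sS0 f) (dS0 f df) => // t; rewrite hS.
exists S; split; last first.
  move=> t f e e0; have ex0 : 0 < expR (w * t) by exact: expR_gt0.
  have [h [n [h0 hn]]] := apS0 t f (e / expR (w * t)) (divr_gt0 e0 ex0).
  exists (w + h^-1), n; split; first by rewrite ltrDl invr_gt0.
  rewrite -eJ hS -scalerBr normrZ gtr0_norm // mulrC.
  by rewrite -ler_pdivlMr.
split.
  split=> // [t t0|f]; first exact: norm_bound_continuous (bS t t0).
  rewrite (_ : (fun t => _) = (fun t => expR (w * t) *: S0 t f)); last first.
    by apply/funext => t; rewrite hS.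
  rewrite -[X in _ --> X]scale1r; apply: cvgZ => //.
  rewrite -[X in _ --> X](expR0 R) -[X in expR X](mulr0 w).
  apply: cvg_at_right_filter; apply: continuous_comp.
    by apply: cvgMr; exact: cvg_id.
  exact: continuous_expR.
have dE f : dom C f <-> dom (generator S) f.
  split=> [df|dSf]; first by have /generatorP[] := dS f df.
  set v := generator S f.
  have hf : right_derivative S f v by apply/generatorP.
  have wl : w < w + 1 by rewrite ltrDl.
  pose u := P (w + 1) ((w + 1) *: f - v).
  have du : dom C u by exact: resolvent_dom (hP _ wl).
  have h := right_derivative_linear (a := -1) (dS u du) hf.
  have e0 := generator_injective aS idS M0 w0 bS wl h.
  suff -> : f = u by [].
  have : -1 *: u + f = 0.
    apply: e0; have := resolvent_eq ((w + 1) *: f - v) (hP _ wl); rewrite -/u => eu.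
    have -> : v = (w + 1) *: f - ((w + 1) *: u - C u) by rewrite eu; lmod R E.
    by lmod R E.
  by rewrite scaleN1r addrC => /eqP; rewrite subr_eq0 => /eqP.
split; first by apply/seteqP; split=> f /dE.
by move=> f df; have /generatorP[] := dS f df.
Qed.

End HilleYosida.

(** * Perturbation of the resolvent *)

Section MethodOfContinuity.
Variables (R : realType) (E : completeNormedModType R) (K : {linear E -> E}).

(** The a priori bound makes the set of [s] with [1 - s K] onto both open and
    closed, with steps of a length that does not depend on [s]. *)
Lemma method_of_continuity (k c : R) : 0 < k -> 0 < c -> norm_bound k K ->
  (forall s x, 0 <= s <= 1 -> `|x| <= c * `|x - s *: K x|) ->
  forall g, exists x, x - K x = g.
Proof.
move=> k0 c0 hk hc.
pose onto s := forall g, exists x, x - s *: K x = g.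
have step s t : 0 <= s <= 1 -> `|t - s| * (c * k) <= 2^-1 -> onto s -> onto t.
  move=> s01 st /choice[Sol hSol] g.
  have dSol a b : `|Sol a - Sol b| <= c * `|a - b|.
    apply: le_trans (hc s _ s01) _; rewrite linearB.
    have -> : a - b = Sol a - s *: K (Sol a) - (Sol b - s *: K (Sol b)).
      by rewrite !hSol.
    by rewrite le_eqVlt; apply/orP; left; apply/eqP; congr (_ * `|_|); lmod R E.
  pose F x := Sol (g + (t - s) *: K x).
  have ctr : is_contraction (totalfun F : {fun [set: E] >-> [set: E]}).
    exists (2^-1)%:nng; split=> /=; first by rewrite invf_lt1 // ltr1n.
    move=> [x y] _ /=; apply: le_trans (dSol _ _) _.
    have -> : g + (t - s) *: K x - (g + (t - s) *: K y) = (t - s) *: K (x - y).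
      by rewrite linearB; lmod R E.
    rewrite normrZ; apply: (@le_trans _ _ (c * (`|t - s| * (k * `|x - y|)))).
      by rewrite ler_wpM2l ?ler_wpM2l // ltW.
    have -> : c * (`|t - s| * (k * `|x - y|)) = `|t - s| * (c * k) * `|x - y|.
      by ring.
    exact: ler_wpM2r.
  have [x _ ex] := banach_fixed_point ctr closedT (ex_intro _ 0 I).
  exists x; have := hSol (g + (t - s) *: K x); rewrite -/(F x).
  rewrite -[F x]/(totalfun F x) -ex => e.
  by rewrite -[RHS](addrK ((t - s) *: K x)) -e; lmod R E.
pose n := (Num.truncn (2 * (c * k))).+1.
have n0 : 0 < (n%:R : R) by rewrite ltr0n.
have hn : n%:R^-1 * (c * k) <= 2^-1.
  rewrite mulrC ler_pdivrMr //.
  have := truncnS_gt (2 * (c * k)); rewrite -/n; lra.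
have on m : (m <= n)%N -> onto (m%:R / n%:R).
  elim: m => [|m ih] mn g; first by exists g; rewrite mul0r scale0r subr0.
  apply: (step (m%:R / n%:R)) (ih (ltnW mn)) g.
    by rewrite divr_ge0 //= ler_pdivrMr // mul1r ler_nat ltnW.
  rewrite -mulrBl -natr1 addrAC subrr add0r mul1r.
  by rewrite ger0_norm // invr_ge0 ltW.
move=> g; have [x] := on n (leqnn n) g.
by rewrite mulfV ?gt_eqF // scale1r => <-; exists x.
Qed.

End MethodOfContinuity.

(** [Q l] plays the resolvent of the generator and [K l] the operator
    [(l - A_{-1})^-1 B]; the hypothesis [hK] is what the resolvent identity
    gives for it. [P] is [(1 - K l0)^-1]. *)
Section PerturbedResolvent.
Variables (R : realType) (E : banachLatticeType R).
Variables (Q K : R -> {linear E -> E}) (P : {linear E -> E}) (l0 c : R).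
Hypothesis Q_pos : forall l, l0 <= l -> positive_op (Q l).
Hypothesis K_pos : forall l, l0 <= l -> positive_op (K l).
Hypothesis hK : forall l f, l0 <= l -> K l0 f - K l f = (l - l0) *: Q l (K l0 f).
Hypothesis P_pos : positive_op P.
Hypothesis PK : forall f, P (f - K l0 f) = f.
Hypotheses (c0 : 0 < c) (P_le : norm_bound c P).
Implicit Types (f g h x : E) (l s : R).

Let K_le l f : l0 <= l -> 0 <=v f -> K l f <=v K l0 f.
Proof.
move=> ll f0; apply/vsubr_ge0; rewrite hK //.
by apply: scaler_vge0; [rewrite subr_ge0 | apply/Q_pos/K_pos].
Qed.

(** Apply the positive operator [P] to [h - K l0 h <= g]. *)
Lemma domination g h : h <=v g + K l0 h -> h <=v P g.
Proof.
move=> hg; rewrite -[X in X <=v _](PK h); apply: positive_le => //.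
by have := vleD2r (- K l0 h) hg; rewrite addrK.
Qed.

Lemma a_priori l s x : l0 <= l -> 0 <= s <= 1 ->
  vabs x <=v P (vabs (x - s *: K l x)).
Proof.
move=> ll /andP[s0 s1]; apply: domination.
have h1 : vabs (K l x) <=v K l0 (vabs x).
  by apply: vle_trans (positive_abs _ (K_pos ll)) _; apply: K_le (vabs_ge0 _).
have h2 : s *: vabs (K l x) <=v K l0 (vabs x).
  apply: vle_trans (vleZ s0 h1) _; apply/vsubr_ge0.
  rewrite -{1}[K l0 _]scale1r -scalerBl; apply: scaler_vge0; first by rewrite subr_ge0.
  exact/K_pos/vabs_ge0.
set y := x - _; have ex : x = y + s *: K l x by rewrite subrK.
have hK1 : s *: K l x <=v s *: vabs (K l x) by apply: vleZ => //; exact: vle_abs.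
have hK2 : - (s *: K l x) <=v s *: vabs (K l x).
  by rewrite -scalerN; apply: vleZ => //; exact: vleN_abs.
apply: vabs_le; first rewrite {1}ex.
  by apply: vleD; [exact: vle_abs | exact: vle_trans hK1 h2].
have -> : - x = - y + - (s *: K l x) by rewrite /y; lmod R E.
by apply: vleD; [exact: vleN_abs | exact: vle_trans hK2 h2].
Qed.

Lemma a_priori_norm l s x : l0 <= l -> 0 <= s <= 1 ->
  `|x| <= c * `|x - s *: K l x|.
Proof.
move=> ll s01; apply: le_trans (vnorm_le (a_priori x ll s01)) _.
by apply: le_trans (P_le _) _; rewrite vnorm_abs.
Qed.

(** Surjectivity of [1 - K l] comes from the method of continuity and [a_priori].
    If [x - K l x >= 0], then [vneg x <= K l (vneg x) <= K l0 (vneg x)], which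
    [domination] allows for [vneg x = 0] only. *)
Lemma neumann_inverse l : l0 <= l -> exists V : {linear E -> E},
  positive_op V /\ forall x g, x - K l x = g <-> x = V g.
Proof.
move=> ll; have [k k0 hk] := positive_bounded (K_pos ll).
have /choice[V0 hV0] :=
  method_of_continuity k0 c0 hk (fun s x => a_priori_norm x ll).
have one01 : 0 <= (1 : R) <= 1 by rewrite ler01 lexx.
have inj x y : x - K l x = y - K l y -> x = y.
  move=> e; apply/eqP; rewrite -subr_eq0 -normr_le0.
  apply: le_trans (a_priori_norm _ ll one01) _.
  rewrite scale1r linearB.
  have -> : x - y - (K l x - K l y) = (x - K l x) - (y - K l y) by lmod R E.
  by rewrite e subrr normr0 mulr0.
have [V hV] : exists V : {linear E -> E}, V =1 V0.
  apply: linear_bundle => a f g; apply: inj; rewrite hV0 linearP.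
  by rewrite -[in LHS](hV0 f) -[in LHS](hV0 g); lmod R E.
have VP x g : x - K l x = g <-> x = V g.
  rewrite hV; split=> [e|->]; last exact: hV0.
  by apply: inj; rewrite hV0.
exists V; split=> // g g0; have /VP e : V g = V g by [].
apply: vneg_eq0; apply: vle_anti (vneg_ge0 _); set x := V g in e *.
have h1 : vneg x <=v K l (vneg x).
  apply: vneg_le; first exact/K_pos/vneg_ge0.
  have -> : - x = K l (- x) - g by rewrite -e linearN; lmod R E.
  have := vleD (positive_le (K_pos ll) (vleN_neg x)) (vle_oppr_le0 g0).
  by rewrite addr0.
have : vneg x <=v 0 + K l0 (vneg x).
  by rewrite add0r; apply: vle_trans h1 _; apply: K_le (vneg_ge0 _).
by move/domination; rewrite linear0.
Qed.

(** The only place where the norm has to be an AM-norm. With [f_ n] the iterates,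
    [h := sup_(k <= n) f_ k] and [v := K l0 h], one gets
    [f_ n - v <= G (f_ n.-1 - v)] for [G := (l - w) Q l], whence
    [h <= sup_(k <= n) G^k f + K l0 h], to which [domination] applies. *)
Lemma perturbed_power_bound (V : {linear E -> E}) (l w M : R) n :
  AM_space E -> l0 <= w -> w < l -> 0 <= M -> positive_op V ->
  (forall x g, x - K l x = g <-> x = V g) ->
  (forall n, norm_bound M (iter n (fun f => (l - w) *: Q l f))) ->
  norm_bound (c * M) (iter n (fun f => (l - w) *: V (Q l f))).
Proof.
move=> hE l0w wl M0 V_pos hV hM f.
have ll : l0 <= l by exact/(le_trans l0w)/ltW.
have lw0 : 0 <= l - w by rewrite subr_ge0 ltW.
have [G hG] : exists G : {linear E -> E}, G =1 fun f => (l - w) *: Q l f.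
  by apply: linear_bundle => a u v; rewrite linearP; lmod R E.
have [J hJ] : exists J : {linear E -> E}, J =1 fun f => (l - w) *: V (Q l f).
  by apply: linear_bundle => a u v; rewrite (linearP (Q l)) (linearP V); lmod R E.
rewrite -(eq_iter hJ).
have G_pos : positive_op G by move=> u u0; rewrite hG; apply: scaler_vge0 => //; exact: Q_pos.
have J_pos : positive_op J.
  by move=> u u0; rewrite hJ; apply: scaler_vge0 => //; apply/V_pos/Q_pos.
have G_le m : norm_bound M (iter m G) by move=> u; rewrite (eq_iter hG); exact: hM.
have JG u : J u = G u + K l (J u).
  have /hV e : V (G u) = V (G u) by [].
  have -> : J u = V (G u) by rewrite hJ hG linearZZ.
  by rewrite -{2}e subrK.
pose a := vabs f; have a0 : 0 <=v a by exact: vabs_ge0.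
pose u m := iter m J a; have u0 m : 0 <=v u m by exact: positive_iter.
pose g m := iter m G a; have g0 m : 0 <=v g m by exact: positive_iter.
pose h := vsup u n; have h0 : 0 <=v h by exact: vle_trans (u0 0%N) (vle_sup _ _).
pose v := K l0 h; have v0 : 0 <=v v by exact: K_pos.
have Gv : G v + K l h <=v v.
  have ev : v = G v + K l h + (w - l0) *: Q l v.
    have := hK h ll; rewrite -/v hG => e; rewrite -[LHS](subrK (K l h)) e.
    by lmod R E.
  rewrite [X in _ <=v X]ev -[X in X <=v _]addr0; apply: vleD.
    exact: vle_refl.
  by apply: scaler_vge0; [rewrite subr_ge0 | exact: Q_pos].
have key m : (m <= n)%N -> u m - v <=v g m - iter m G v.
  elim: m => [|m ih] mn; first exact: vle_refl.
  have -> : g m.+1 - iter m.+1 G v = G (g m - iter m G v) by rewrite linearB.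
  apply: vle_trans (positive_le G_pos (ih (ltnW mn))); rewrite linearB.
  have -> : u m.+1 = G (u m) + K l (u m.+1) by exact: JG.
  rewrite -addrA; apply: vleD; first exact: vle_refl.
  apply: vle_trans (vleD2r (- v) (positive_le (K_pos ll) (vle_sup u mn))) _.
  have := vleD2r (- v - G v) Gv; rewrite -/h.
  have -> : v + (- v - G v) = - G v by lmod R E.
  by have -> : G v + K l h + (- v - G v) = K l h - v by lmod R E.
have hh : h <=v vsup g n + K l0 h.
  apply: vsup_le => m mn; rewrite -/v; apply/vsubr_ge0.
  have -> : vsup g n + v - u m = (vsup g n - g m) + iter m G v +
      (g m - iter m G v - (u m - v)) by lmod R E.
  by apply: vaddr_ge0; [apply: vaddr_ge0; [apply/vsubr_ge0/vle_sup
    | exact: positive_iter] | apply/vsubr_ge0/key].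
have sg : `|vsup g n| <= M * `|f|.
  apply: (AM_vsup_norm n hE g0) => m; rewrite -(vnorm_abs f); exact: G_le.
apply: le_trans (vnorm_le (positive_iter_abs n f J_pos)) _.
apply: le_trans (vnorm_le_pos (u0 n) (vle_sup u (leqnn n))) _.
apply: le_trans (vnorm_le_pos h0 (domination hh)) _.
by apply: le_trans (P_le _) _; rewrite -mulrA; apply: ler_wpM2l => //; exact: ltW.
Qed.

End PerturbedResolvent.

(** * The extrapolation space *)

Section ExtrapolationSpace.
Variables (R : realType) (E : banachLatticeType R) (A : operator E E).
Variables (T : R -> {linear E -> E}) (mu : R) (Em1 : completeNormedModType R).
Variables (j : {linear E -> Em1}) (Tm1 : R -> {linear Em1 -> Em1}).
Variables (P : {linear E -> E}).
Hypothesis hA : generates A T.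
Hypothesis hP : resolvent_of A mu P.
Hypothesis cP : continuous P.
Hypothesis j_norm : forall f, `|j f| = `|P f|.
Hypothesis j_dense : dense (range j).
Hypothesis hTm1 : extrapolated_semigroup j T Tm1.
Implicit Types (f g x : E) (y : Em1) (l t e : R).
Local Notation Am1 := (generator Tm1).

Let quotient f t : E := t^-1 *: (T t f - f).

Let P_quotient f e : 0 < e -> exists2 d, 0 < d &
  forall t, 0 < t < d -> `|mu *: P f - f - P (quotient f t)| <= e.
Proof.
move=> e0; have /right_derivativeP/(_ e e0)[d d0 hd] :
    right_derivative T (P f) (A (P f)).
  by apply/(generatesP hA); split=> //; exact: resolvent_dom hP.
exists d => // t td; have := hd t td; rewrite (resolvent_app f hP).
have t0 : 0 <= t by case/andP: td => /ltW.
by rewrite /quotient (linearZZ P) (linearB P) (resolvent_commutes hA _ hP t0).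
Qed.

Let Tm1_quotient f t : 0 < t ->
  t^-1 *: (Tm1 t (j f) - j f) = j (quotient f t).
Proof.
by move=> t0; rewrite (hTm1 (ltW t0)).2 /quotient (linearZZ j) (linearB j).
Qed.

Let j_inj : injective j.
Proof.
move=> f g e; apply: (resolvent_inj hP); apply/eqP.
by rewrite -subr_eq0 -linearB -normr_eq0 -j_norm linearB e subrr normr0.
Qed.

Lemma in_EK f : in_E j (j f) = f.
Proof.
rewrite /in_E; case: xgetP => [_ -> /= /j_inj //|].
by move=> /(_ f) [].
Qed.

(** The difference quotients of [j f] are Cauchy, because [P] maps those of [f]
    to a convergent family and [j] carries the norm [`|P f|]. *)
Lemma extr_derivative f : right_derivative Tm1 (j f) (Am1 (j f)).
Proof.
apply/generatorP; split=> //=; apply: cvg_of_approximants => e e0.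
have e40 : 0 < e / 4 by rewrite divr_gt0.
have [d d0 hd] := P_quotient f e40.
have d20 : 0 < d / 2 by rewrite divr_gt0.
exists (j (quotient f (d / 2))); apply/near_right0; exists d => // t td.
have t0 : 0 < t by case/andP: td.
rewrite Tm1_quotient // -linearB j_norm linearB.
have h1 := hd t td; have /hd h2 : 0 < d / 2 < d.
  by rewrite d20 ltr_pdivrMr // ltr_pMr // ltr1n.
have := ler_distD (mu *: P f - f) (P (quotient f (d / 2))) (P (quotient f t)).
by rewrite (distrC (P (quotient f (d / 2))) (mu *: P f - f)); lra.
Qed.

(** [V] is [mu - A_{-1}], transported to [E] by [j]. It turns out to be an
    isometry of [E] onto [Em1] under which [j] becomes [P], and the remaining
    data of the extrapolation space become operators on [E]. *)
Definition extr_iso f : Em1 := mu *: j f - Am1 (j f).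
Local Notation V := extr_iso.

Let V_linear : linear V.
Proof.
move=> a f g; rewrite /V linearP.
have /generatorP[_ ->] :=
  right_derivative_linear (a := a) (@extr_derivative f) (@extr_derivative g).
by lmod R Em1.
Qed.

Lemma extr_iso_norm f : `|V f| = `|f|.
Proof.
apply/eqP; rewrite -subr_eq0 -normr_le0; apply/ler_addgt0Pr => e e0.
have e20 : 0 < e / 2 by rewrite divr_gt0.
have [d1 d10 hd1] := P_quotient f e20.
have /right_derivativeP/(_ _ e20)[d2 d20 hd2] := @extr_derivative f.
pose t := Num.min d1 d2 / 2.
have m0 : 0 < Num.min d1 d2 by rewrite lt_min d10.
have t0 : 0 < t by rewrite divr_gt0.
have : t < Num.min d1 d2 by rewrite ltr_pdivrMr // ltr_pMr // ltr1n.
rewrite lt_min => /andP[t1 t2].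
have h1 : `|f - (mu *: P f - P (quotient f t))| <= e / 2.
  have := hd1 t; rewrite t0 t1 => /(_ isT).
  by rewrite -normrN; congr (_ <= _); congr `|_|; lmod R E.
have h2 : `|V f - j (mu *: f - quotient f t)| <= e / 2.
  have := hd2 t; rewrite t0 t2 Tm1_quotient // => /(_ isT).
  rewrite -normrN; congr (_ <= _); congr `|_|.
  by rewrite /V (linearB j) !(linearZZ j); lmod R Em1.
have h3 : `|j (mu *: f - quotient f t)| = `|mu *: P f - P (quotient f t)|.
  by rewrite j_norm linearB linearZZ.
have := ler_dist_dist (V f) (j (mu *: f - quotient f t)).
have := ler_dist_dist (mu *: P f - P (quotient f t)) f.
have := ler_distD (`|j (mu *: f - quotient f t)|) `|V f| `|f|.
rewrite {2}h3 (distrC _ f); lra.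
Qed.

Lemma extr_isoP f : V (P f) = j f.
Proof.
have [c c0 hc] := continuous_norm_bound cP.
have /generatorP[_ e] : right_derivative Tm1 (j (P f)) (j (A (P f))).
  have /right_derivativeP hf : right_derivative T (P f) (A (P f)).
    by apply/(generatesP hA); split=> //; exact: resolvent_dom hP.
  apply/right_derivativeP => e e0.
  have [d d0 hd] := hf _ (divr_gt0 e0 c0); exists d => // t td.
  have t0 : 0 < t by case/andP: td.
  rewrite Tm1_quotient // -linearB j_norm; apply: le_trans (hc _) _.
  by rewrite mulrC -ler_pdivlMr //; exact: hd.
by rewrite /V e (resolvent_app f hP) linearB linearZZ; lmod R Em1.
Qed.

Lemma extr_isoB f g : V (f - g) = V f - V g.
Proof.
have := V_linear (-1) g f; rewrite scaleN1r [in LHS]addrC => ->.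
by lmod R Em1.
Qed.

Lemma extr_isoD f g : V (f + g) = V f + V g.
Proof. by have := V_linear 1 f g; rewrite !scale1r. Qed.

Lemma extr_isoZ a f : V (a *: f) = a *: V f.
Proof.
have V0 : V 0 = 0 by rewrite -(subrr (0 : E)) extr_isoB subrr.
by have := V_linear a f 0; rewrite V0 !addr0.
Qed.

Lemma extr_iso_inj : injective V.
Proof.
move=> f g e; apply/eqP.
by rewrite -subr_eq0 -normr_eq0 -extr_iso_norm extr_isoB e subrr normr0.
Qed.

(** If [j (g n)] tends to [y], then [P (g n)] is Cauchy and its limit is the
    preimage of [y]. *)
Lemma extr_iso_onto y : exists f, V f = y.
Proof.
have /choice[g hg] : forall n : nat, exists g, `|y - j g| < n.+1%:R^-1.
  move=> n; have [|x [yx [g _ gx]]] := j_dense (O := ball y n.+1%:R^-1) _ (ball_open _ _).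
  - by exists y; apply: ballxx; rewrite invr_gt0.
  - by exists g; rewrite gx; move: yx; rewrite -ball_normE.
have small e : 0 < e -> exists N, forall n, (N <= n)%N -> `|y - j (g n)| < e.
  move=> e0; exists (Num.truncn e^-1) => n Nn; apply: lt_trans (hg n) _.
  rewrite -[e]invrK ltf_pV2 ?posrE ?invr_gt0 //.
  by apply: lt_le_trans (truncnS_gt _) _; rewrite ler_nat.
have cg : cvgn (fun n => P (g n)).
  apply: cvg_of_approximants => e e0; have [|N hN] := small (e / 2).
    by rewrite divr_gt0.
  exists (P (g N)), N => // n /= Nn; rewrite -linearB -j_norm linearB.
  have := hN _ Nn; have := hN _ (leqnn N).
  by have := ler_distD y (j (g N)) (j (g n)); rewrite (distrC (j (g N)) y); lra.
exists (limn (fun n => P (g n))); apply/eqP; rewrite -subr_eq0 -normr_le0.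
apply/ler_addgt0Pr => e e0; rewrite add0r.
have e20 : 0 < e / 2 by rewrite divr_gt0.
have [N hN] := small _ e20.
have /cvgrPdist_le/(_ _ e20)[N' _ hN'] := cg.
have := hN' (maxn N N') (leq_maxr _ _); rewrite /= -extr_iso_norm extr_isoB extr_isoP.
have := hN (maxn N N') (leq_maxl _ _).
set x := V _; have := ler_distD (j (g (maxn N N'))) x y.
by rewrite (distrC (j _) y); lra.
Qed.

Let V_semigroup t f : 0 <= t -> Tm1 t (V f) = V (T t f).
Proof.
move=> t0; have [c1 c10 h1] := continuous_norm_bound (hTm1 t0).1.
have [c2 c20 h2] := continuous_norm_bound (C0_bounded hA.1 t0).
apply/eqP; rewrite -subr_eq0 -normr_le0; apply/ler_addgt0Pr => e e0.
rewrite add0r; have c0 : 0 < c1 + c2 by rewrite addr_gt0.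
have [g dg fg] := generates_dense hA f hP (divr_gt0 e0 c0).
have eg : Tm1 t (V g) = V (T t g).
  rewrite -(resolventK hP dg) extr_isoP (hTm1 t0).2.
  by rewrite -(resolvent_commutes hA _ hP t0) extr_isoP.
have -> : Tm1 t (V f) - V (T t f) = Tm1 t (V (f - g)) - V (T t (f - g)).
  have -> : Tm1 t (V (f - g)) = Tm1 t (V f) - V (T t g).
    by rewrite extr_isoB linearB eg.
  by rewrite [T t (f - g)]linearB extr_isoB; lmod R Em1.
apply: le_trans (ler_normB _ _) _; rewrite extr_iso_norm.
have := h1 (V (f - g)); rewrite extr_iso_norm => h3; have h4 := h2 (f - g).
have : (c1 + c2) * `|f - g| <= e by rewrite mulrC -ler_pdivlMr.
lra.
Qed.

(** [V] intertwines the semigroups, so difference quotients converge in [Em1]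
    only if their preimages do in [E]; and [V] maps [dom A], the range of [P],
    onto the range of [j]. *)
Lemma extr_dom y : dom Am1 y -> range j y.
Proof.
have [f <-] := extr_iso_onto y => dy.
have df : dom A f.
  suff : dom (generator T) f by have [-> _] := hA.2.
  rewrite /=; apply: cvg_of_approximants => e e0.
  have e40 : 0 < e / 4 by rewrite divr_gt0.
  have /right_derivativeP/(_ _ e40)[d d0 hd] :
    right_derivative Tm1 (V f) (Am1 (V f)) by apply/generatorP.
  have d20 : 0 < d / 2 by rewrite divr_gt0.
  have q t : 0 < t -> t^-1 *: (Tm1 t (V f) - V f) = V (quotient f t).
    by move=> t0; rewrite V_semigroup ?ltW // -extr_isoB -extr_isoZ.
  exists (quotient f (d / 2)); apply/near_right0; exists d => // t td.
  have t0 : 0 < t by case/andP: td.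
  have h1 := hd t td; have /hd h2 : 0 < d / 2 < d.
    by rewrite d20 ltr_pdivrMr // ltr_pMr // ltr1n.
  rewrite -/(quotient f t) -extr_iso_norm extr_isoB -!q //.
  have := ler_distD (Am1 (V f)) ((d / 2)^-1 *: (Tm1 (d / 2) (V f) - V f))
    (t^-1 *: (Tm1 t (V f) - V f)).
  by rewrite (distrC (_ *: _) (Am1 (V f))); lra.
by exists (mu *: f - A f) => //; rewrite -extr_isoP (resolventK hP df).
Qed.

Section Resolvents.
Variables (l : R) (Q : {linear E -> E}).
Hypothesis hQ : resolvent_of A l Q.

(** [1 + (l - mu) P] and [1 + (mu - l) Q] are inverse to each other: they are
    [(l - A) P] and [(mu - A) Q]. *)
Lemma resolvent_shift x b :
  x + (l - mu) *: P x = b <-> x = b + (mu - l) *: Q b.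
Proof.
split=> [<-|->]; first by rewrite (resolvent_identity x hQ hP); lmod R E.
by rewrite (resolvent_identity b hP hQ); lmod R E.
Qed.

Lemma extr_resolventP x b :
  l *: j x - Am1 (j x) = V b <-> x = b + (mu - l) *: Q b.
Proof.
rewrite -resolvent_shift.
have -> : l *: j x - Am1 (j x) = V (x + (l - mu) *: P x).
  by rewrite [x + _]addrC V_linear extr_isoP /V; lmod R Em1.
by split=> [/extr_iso_inj|->].
Qed.

Lemma extr_resolvent b : in_E j (resolvent Am1 l (V b)) = b + (mu - l) *: Q b.
Proof.
set x := b + _; have ex : l *: j x - Am1 (j x) = V b by apply/extr_resolventP.
rewrite -[RHS]in_EK; congr in_E; rewrite /resolvent; case: xgetP => [_ -> /=|].
  by move=> [/extr_dom[z _ <-]] /extr_resolventP ->.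
move=> /(_ (j x))[]; split=> //.
by have /generatorP[] := @extr_derivative x.
Qed.

(** [V b] is a limit of [j g = V (P g)] with [g >= 0], so [b] is a limit of
    [P g], and [1 + (mu - l) Q] maps [P g] to [Q g >= 0]. *)
Lemma extr_resolvent_pos b : positive_op Q -> continuous Q ->
  extr_cone j (V b) -> 0 <=v b + (mu - l) *: Q b.
Proof.
move=> Q_pos cQ hb; have [c c0 hc] := continuous_norm_bound cQ.
pose a := 1 + `|mu - l| * c.
have a0 : 0 < a by rewrite ltr_wpDr // mulr_ge0 // ltW.
apply: vge0_approx => e e0; have ea0 : 0 < e / a by rewrite divr_gt0.
have [_ [[g g0 <-] yg]] := hb _ (nbhsx_ballx _ _ ea0).
exists (Q g); first exact: Q_pos.
have bg : `|b - P g| <= e / a.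
  rewrite -extr_iso_norm extr_isoB extr_isoP.
  by apply/ltW; move: yg; rewrite -ball_normE.
have -> : b + (mu - l) *: Q b - Q g = (b - P g) + (mu - l) *: Q (b - P g).
  have := resolvent_identity g hQ hP; rewrite linearD linearZZ linearB => eg.
  rewrite -[X in (b - X) + _]eg; lmod R E.
apply: le_trans (ler_normD _ _) _; rewrite normrZ.
apply: (@le_trans _ _ (a * `|b - P g|)); last by rewrite mulrC -ler_pdivlMr.
by rewrite mulrDl mul1r lerD2l -mulrA; apply: ler_wpM2l.
Qed.

(** Transported by [V], the equation reads [mu P f - f + b f = P (l f - g)]; apply
    [1 + (mu - l) Q] to it. *)
Lemma part_pert_resolventP (B : E -> Em1) (b : E -> E) f g :
  (forall f, V (b f) = B f) ->
  (dom (part_pert j Am1 B) f /\ l *: f - part_pert j Am1 B f = g) <->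
  f - (b f + (mu - l) *: Q (b f)) = Q g.
Proof.
move=> hb; have eAB : Am1 (j f) + B f = V (mu *: P f - f + b f).
  by rewrite extr_isoD extr_isoB extr_isoZ extr_isoP hb /V; lmod R Em1.
have shift h : f - (b f + (mu - l) *: Q (b f)) = Q h <->
    mu *: P f - f + b f = P (l *: f - h).
  have eQ : Q h = P h + (mu - l) *: Q (P h).
    have := resolvent_identity h hQ hP; rewrite linearD linearZZ => e.
    by rewrite -{1}e; lmod R E.
  have -> : f - (b f + (mu - l) *: Q (b f)) = Q h <->
      f = b f + P h + (mu - l) *: Q (b f + P h).
    have eqd : f - (b f + (mu - l) *: Q (b f)) - Q h =
        f - (b f + P h + (mu - l) *: Q (b f + P h)).
      by rewrite [Q (b f + P h)]linearD eQ; lmod R E.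
    by split=> e; apply/eqP; rewrite -subr_eq0; [rewrite -eqd | rewrite eqd];
      rewrite subr_eq0; apply/eqP.
  rewrite -resolvent_shift linearB linearZZ; split=> e.
    by rewrite -[P h](addKr (b f)) -e; lmod R E.
  have -> : P h = l *: P f - (l *: P f - P h) by lmod R E.
  by rewrite -e; lmod R E.
split=> [[[_ [h _ eh]] <-]|/shift e].
  apply/shift; apply: extr_iso_inj; rewrite -eAB -eh /= -eh in_EK extr_isoP.
  by congr (j _); lmod R E.
have eh : Am1 (j f) + B f = j (l *: f - g) by rewrite eAB e extr_isoP.
split; last by rewrite /= eh in_EK; lmod R E.
split; first by have /generatorP[] := @extr_derivative f.
by exists (l *: f - g).
Qed.

End Resolvents.

End ExtrapolationSpace.

(** * Behaviour of resolvents at infinity *)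

Section ResolventAtInfinity.
Variables (R : realType) (E : normedModType R) (A : operator E E).
Variables (Q : R -> {linear E -> E}) (w M : R).
Hypothesis M0 : 0 < M.
Hypothesis hQ : forall l, w < l -> resolvent_of A l (Q l).
Hypothesis hM : forall l f, w < l -> `|(l - w) *: Q l f| <= M * `|f|.

Lemma resolvent_vanishes f e : 0 < e ->
  exists L, forall l, w < l -> L < l -> `|Q l f| <= e.
Proof.
move=> e0; exists (w + M * `|f| / e) => l wl Ll.
have lw : 0 < l - w by rewrite subr_gt0.
have := hM f wl; rewrite normrZ gtr0_norm // -ler_pdivlMl // => /le_trans; apply.
by rewrite ler_pdivrMl // -ler_pdivrMr // lerBrDl ltW.
Qed.

Lemma scaled_resolvent_approx f e :
  (forall f e, 0 < e -> exists2 g, dom A g & `|f - g| <= e) -> 0 < e ->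
  exists L, forall l, w < l -> L < l -> `|(l - w) *: Q l f - f| <= e.
Proof.
move=> hD e0; have M10 : 0 < M + 1 by rewrite addr_gt0.
have [g dg fg] := hD f (e / (2 * (M + 1))) (divr_gt0 e0 (mulr_gt0 (ltr0Sn R 1) M10)).
have [L hL] := resolvent_vanishes (A g - w *: g) (divr_gt0 e0 (ltr0Sn R 1)).
exists L => l wl Ll.
have -> : (l - w) *: Q l f - f =
    (l - w) *: Q l (f - g) + Q l (A g - w *: g) - (f - g).
  have := resolventK (hQ wl) dg; rewrite linearB linearZZ => eg.
  rewrite (linearB (Q l)) (linearB (Q l) (A g)) linearZZ.
  by rewrite -[X in _ - (f - X)]eg; lmod R E.
apply: le_trans (ler_normB _ _) _.
have h1 := hM (f - g) wl; have h2 := hL l wl Ll.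
have := ler_normD ((l - w) *: Q l (f - g)) (Q l (A g - w *: g)).
have : (M + 1) * `|f - g| <= e / 2.
  have := ler_wpM2l (ltW M10) fg.
  by rewrite (_ : _ * (e / _) = e / 2) //; field; rewrite gt_eqF.
lra.
Qed.

End ResolventAtInfinity.

(** * The perturbation theorem *)

Lemma spectral_bound_resolvent (R : realType) (E : normedModType R)
    (A : operator E E) (l m : R) :
  (spectral_bound A < l%:E)%E -> l <= m -> resolvent_set A m%:C%C.
Proof.
move=> hl lm; apply: contrapT => nr; move: hl; rewrite ltNge => /negP; apply.
apply: (@le_trans _ _ m%:E); first by rewrite lee_fin.
by apply: ereal_sup_ubound; exists m%:C%C.
Qed.

Lemma spectral_radius_resolvent (R : realType) (E : normedModType R)
    (K : E -> E) (m : R) :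
  (spectral_radius K < 1)%E -> 1 <= m -> resolvent_set (Operator setT K) m%:C%C.
Proof.
move=> hl lm; apply: contrapT => nr; move: hl; rewrite ltNge => /negP; apply.
apply: (@le_trans _ _ m%:E); first by rewrite lee_fin.
apply: ereal_sup_ubound; exists m%:C%C => //=.
by rewrite expr0n addr0 sqrtr_sqr ger0_norm // (le_trans ler01).
Qed.

(** The half line [r >= 1] lies in the resolvent set, and [(r - K)^-1] is positive
    for [r] above the norm of [K], hence down to [r = 1]. *)
Lemma positive_neumann (R : realType) (E : banachLatticeType R)
    (K : {linear E -> E}) :
  positive_op K -> (spectral_radius K < 1)%E ->
  exists P : {linear E -> E}, [/\ positive_op P, continuous P &
    forall f, P (f - K f) = f].
Proof.
move=> K_pos hK; pose AK : operator E E := Operator setT K.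
have lK : linear_operator AK by move=> a f g _ _; split=> //; exact: linearP.
have /choice[S hS] : forall r : R, exists S : {linear E -> E}, 1 <= r ->
    continuous S /\ resolvent_of AK r S.
  move=> r; have [r1|r1] := leP 1 r; last by exists K.
  by have [S hS] := real_resolvent lK (spectral_radius_resolvent hK r1); exists S.
have [k k0 hk] := positive_bounded K_pos.
have S_large r : k + 1 <= r -> positive_op (S r).
  move=> kr g g0; have r0 : 0 < r by apply: lt_le_trans kr; rewrite addr_gt0.
  have r1 : 1 <= r by apply: le_trans kr; rewrite lerDr ltW.
  apply: (positive_contraction (d := r^-1) K_pos hk).
  - by rewrite invr_ge0 ltW.
  - by rewrite mulrC ltr_pdivrMr // mul1r; lra.
  - have := resolvent_eq g (hS r r1).2 => /= e.
    have -> : r^-1 *: K (S r g) = S r g - r^-1 *: g.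
      by rewrite -[X in _ - _ *: X]e; lmod_coefs R E => //; field; rewrite gt_eqF.
    apply/vsubr_ge0; rewrite opprB addrC subrK.
    by apply: scaler_vge0 => //; rewrite invr_ge0 ltW.
have [c1 r1] := hS 1 (lexx 1); exists (S 1); split=> //.
  exact: (resolvent_positive hS S_large).
by move=> f; have := resolventK r1 (I : dom AK f); rewrite scale1r.
Qed.

Theorem theorem1p2 (R : realType) (E : banachLatticeType R) (hE : AM_space E)
    (A : operator E E) (T : R -> {linear E -> E})
    (hA : generates A T) (hT : positive_semigroup T)
    (mu : R) (Em1 : completeNormedModType R) (j : {linear E -> Em1})
    (hEm1 : extrapolation_space j A mu)
    (Tm1 : R -> {linear Em1 -> Em1}) (hTm1 : extrapolated_semigroup j T Tm1)
    (B : {linear E -> Em1}) (hB : extr_positive j B)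
    (hspr : exists2 l : R, (spectral_bound A < l%:E)%E &
       (spectral_radius (resolvent_pert j (generator Tm1) B l) < 1)%E) :
  exists S : R -> {linear E -> E},
    generates (part_pert j (generator Tm1) B) S /\ positive_semigroup S.
Proof.
have lA := generates_linear hA.
have [l hl hK1] := hspr.
have [Pm [cPm hPm]] := real_resolvent lA (extr_mu hEm1).
have j_norm f : `|j f| = `|Pm f|.
  by rewrite (extr_norm hEm1) (resolvent_ofE hPm).
have j_dense := extr_dense hEm1.
have /choice[Q hQ] : forall m : R, exists Q : {linear E -> E}, l <= m ->
    continuous Q /\ resolvent_of A m Q.
  move=> m; have [lm|ml] := leP l m; last by exists Pm.
  by have [Q hQ] := real_resolvent lA (spectral_bound_resolvent hl lm); exists Q.
have [M [w [M1 w0 lw bT]]] := growth_bound l hA.1.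
have M0 : 0 < M by exact: lt_le_trans M1.
have Q_pos m : l <= m -> positive_op (Q m).
  apply: (resolvent_positive (A := A) (L := w + 1) hQ) => {}m wm.
  have wm1 : w < m by apply: lt_le_trans wm; rewrite ltrDl.
  apply: (generator_resolvent_positive hA hT (ltW M0) w0 bT wm1).
  exact: (hQ m (le_trans lw (ltW wm1))).2.
pose V := extr_iso mu j Tm1.
have /choice[b0 hb0] : forall f, exists g, V g = B f.
  by move=> f; exact: (extr_iso_onto hA hPm cPm j_norm j_dense hTm1).
have V_inj : injective V := extr_iso_inj hA hPm j_norm hTm1.
have [b hb'] : exists b : {linear E -> E}, b =1 b0.
  apply: linear_bundle => a f g; apply: V_inj.
  rewrite /V (extr_isoD hA hPm j_norm hTm1) (extr_isoZ hA hPm j_norm hTm1).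
  by rewrite -/V !hb0 linearP.
have hb f : V (b f) = B f by rewrite hb' hb0.
have /choice[K hK] : forall m : R, exists K : {linear E -> E},
    K =1 fun f => b f + (mu - m) *: Q m (b f).
  move=> m; apply: linear_bundle => a f g.
  by rewrite (linearP b) (linearP (Q m)); lmod R E.
have K_pos m : l <= m -> positive_op (K m).
  move=> lm f f0; rewrite hK.
  apply: (extr_resolvent_pos hA hPm cPm j_norm hTm1 (hQ m lm).2).
  - exact: Q_pos.
  - exact: (hQ m lm).1.
  - by rewrite -/V hb; exact: hB.
have K_id m f : l <= m -> K l f - K m f = (m - l) *: Q m (K l f).
  move=> lm; rewrite !hK.
  have := resolvent_identity (b f) (hQ m lm).2 (hQ l (lexx l)).2.
  rewrite linearD linearZZ => e; rewrite [Q m (_ + _)]linearD [Q m (_ *: _)]linearZZ.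
  have -> : (mu - l) *: Q l (b f) =
      (mu - l) *: (Q m (b f) + (m - l) *: Q m (Q l (b f))) by rewrite e.
  by lmod R E.
have eK : resolvent_pert j (generator Tm1) B l = K l.
  apply/funext => f; rewrite /resolvent_pert -hb hK.
  exact: (extr_resolvent hA hPm cPm j_norm j_dense hTm1 (hQ l (lexx l)).2).
rewrite eK in hK1.
have [P [P_pos cP PK]] := positive_neumann (K_pos l (lexx l)) hK1.
have [c c0 hc] := continuous_norm_bound cP.
have /choice[W hW] : forall m : R, exists W : {linear E -> E}, l <= m ->
    positive_op W /\ forall x g, x - K m x = g <-> x = W g.
  move=> m; have [lm|ml] := leP l m; last by exists Pm.
  by have [W hW] := neumann_inverse Q_pos K_pos K_id P_pos PK c0 hc lm; exists W.
have /choice[U hU] : forall m : R, exists U : {linear E -> E},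
    U =1 fun f => W m (Q m f).
  move=> m; apply: linear_bundle => a f g.
  by rewrite (linearP (Q m)) (linearP (W m)).
have wl m : w < m -> l <= m by move=> wm; exact: le_trans lw (ltW wm).
pose C := part_pert j (generator Tm1) B.
have U_res m : w < m -> resolvent_of C m (U m).
  move=> wm f g; rewrite hU -(hW m (wl m wm)).2 hK.
  exact: (part_pert_resolventP hA hPm cPm j_norm hTm1 (hQ m (wl m wm)).2 f g hb).
have Q_pow m n : w < m -> norm_bound M (iter n (fun f => (m - w) *: Q m f)).
  move=> wm; have [_ idT aT _] := hA.1.
  exact: (resolvent_power_bound aT idT (ltW M0) w0 bT n hA wm (hQ m (wl m wm)).2).
pose M' := Num.max 1 (c * M).
have U_pow m n : w < m -> norm_bound M' (iter n (fun f => (m - w) *: U m f)).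
  move=> wm f; have [W_pos hWm] := hW m (wl m wm).
  rewrite (eq_iter (f' := fun f => (m - w) *: W m (Q m f))); last first.
    by move=> g; rewrite hU.
  apply: (@le_trans _ _ (c * M * `|f|)); last first.
    by rewrite ler_wpM2r // le_max lexx orbT.
  apply: (perturbed_power_bound Q_pos K_pos K_id P_pos PK c0 hc n hE lw wm) => //.
  - exact: ltW.
  - by move=> k; exact: Q_pow.
have Q_bd m f : w < m -> `|(m - w) *: Q m f| <= M * `|f|.
  by move=> wm; exact: (Q_pow m 1%N wm f).
have dA f e : 0 < e -> exists2 g, dom A g & `|f - g| <= e.
  exact: (generates_dense hA f hPm).
(* [x := (m - w) (m - C)^-1 f] satisfies
   [(1 - K m) (x - f) = ((m - w) R m f - f) + K m f], and both terms vanish as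
   [m] grows. *)
have dC f e : 0 < e -> exists2 g, dom C g & `|f - g| <= e.
  move=> e0; have ec0 : 0 < e / (3 * c) by rewrite divr_gt0 // mulr_gt0.
  have Q_res m : w < m -> resolvent_of A m (Q m) by move=> wm; exact: (hQ m (wl m wm)).2.
  have [L1 h1] := scaled_resolvent_approx M0 Q_res Q_bd f dA ec0.
  have [L2 h2] := scaled_resolvent_approx M0 Q_res Q_bd (b f) dA ec0.
  have d0 : 0 < e / (3 * c) / (`|mu - w| + 1) by rewrite divr_gt0 // ltr_wpDl.
  have [L3 h3] := resolvent_vanishes Q_bd (b f) d0.
  pose m := Num.max w (Num.max L1 (Num.max L2 L3)) + 1.
  have big x : x <= Num.max w (Num.max L1 (Num.max L2 L3)) -> x < m.
    by move=> /le_lt_trans; apply; rewrite ltrDl.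
  have wm : w < m by apply: big; rewrite le_max lexx.
  have {}h1 : `|(m - w) *: Q m f - f| <= e / (3 * c).
    by apply: h1 => //; apply: big; rewrite !le_max lexx !orbT.
  have {}h2 : `|(m - w) *: Q m (b f) - b f| <= e / (3 * c).
    by apply: h2 => //; apply: big; rewrite !le_max lexx !orbT.
  have {}h3 : `|Q m (b f)| <= e / (3 * c) / (`|mu - w| + 1).
    by apply: h3 => //; apply: big; rewrite !le_max lexx !orbT.
  exists ((m - w) *: U m f).
    by rewrite -linearZZ; exact: resolvent_dom (U_res m wm).
  set x := _ *: _; have ex : x - K m x = (m - w) *: Q m f.
    by apply/(hW m (wl m wm)).2; rewrite /x hU linearZZ.
  have one01 : 0 <= (1 : R) <= 1 by rewrite ler01 lexx.
  have := a_priori_norm Q_pos K_pos K_id P_pos PK hc (f - x) (wl m wm) one01.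
  move/le_trans; apply.
  have -> : f - x - 1 *: K m (f - x) = - ((m - w) *: Q m f - f) +
      ((m - w) *: Q m (b f) - b f) - (mu - w) *: Q m (b f).
    by rewrite (linearB (K m)) -ex (hK m f); lmod R E.
  rewrite mulrC -ler_pdivlMr //.
  apply: le_trans (ler_normB _ _) _.
  have h4 := ler_normB ((m - w) *: Q m (b f) - b f) ((m - w) *: Q m f - f).
  rewrite addrC in h4.
  have h5 : `|(mu - w) *: Q m (b f)| <= e / (3 * c).
    rewrite normrZ; apply: (@le_trans _ _ ((`|mu - w| + 1) * `|Q m (b f)|)).
      by rewrite ler_wpM2r // lerDl.
    by rewrite mulrC -ler_pdivlMr // ltr_wpDl.
  have -> : e / c = e / (3 * c) + e / (3 * c) + e / (3 * c).
    by field; rewrite gt_eqF.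
  lra.
have M'1 : 1 <= M' by rewrite le_max lexx.
have [S [genS apS]] := hille_yosida w0 M'1 U_res U_pow dC.
exists S; split=> // t t0 f f0; apply: vge0_approx => e e0.
have [m [n [wm hn]]] := apS t f e e0.
exists (expR (w * t) *: iter n (fun f => (m - w) *: U m f) f) => //.
apply: scaler_vge0; first exact: expR_ge0.
elim: n {hn} => //= n ih; apply: scaler_vge0; first by rewrite subr_ge0 ltW.
by rewrite hU; apply: (hW m (wl m wm)).1; exact: (Q_pos m (wl m wm)).
Qed.
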